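(* The Banach algebra $\ell^1(\Sigma)$ has finite dimensional algebraically irreducible representations if and only if $\mathrm{Per}(\sigma)\neq\emptyset$. In that case, let $\mathrm{Per}(\sigma)/\mathbb{Z}$ be the space of finite orbits. If $\mathfrak{o}\in\mathrm{Per}(\sigma)/\mathbb{Z}$ and $\lambda\in\mathbb{T}$, choose $x\in\mathfrak{o}$, and let $\Xi_{\mathfrak{o},\lambda}$ denote the algebraic equivalence class of $\pi_{x,\lambda}$. Then this is well defined (i.e. independent of the choice of $x\in\mathfrak{o}$), and $(\mathfrak{o},\lambda)\mapsto\Xi_{\mathfrak{o},\lambda}$ is a bijection between $(\mathrm{Per}(\sigma)/\mathbb{Z})\times\mathbb{T}$ and the collection of algebraic equivalence classes of finite dimensional algebraically irreducible representations of $\ell^1(\Sigma)$. Each of the representation spaces (of the finite dimensional algebraically irreducible representations) can be supplied with a Hilbert space structure such that the representation is a $*$-representation. In particular, all corresponding primitive ideals are selfadjoint.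
   Context: $X$ is a non-empty compact Hausdorff space, $\sigma:X\to X$ is a homeomorphism, $\Sigma=(X,\sigma)$, and $\mathbb{Z}$ acts on $X$ via $n\mapsto\sigma^n$. $\mathrm{Per}(\sigma)$ is the set of periodic points (points with finite orbit); the period of $x$ is the number of elements of its orbit. $\mathbb{T}=\{\lambda\in\mathbb{C}:|\lambda|=1\}$. $C(X)$ is the algebra of continuous complex-valued functions with the supremum norm, and $\alpha(f)=f\circ\sigma^{-1}$ for $f\in C(X)$. $\ell^1(\Sigma)$ is the Banach space of all $a:\mathbb{Z}\to C(X)$ with $\|a\|=\sum_n\|a(n)\|<\infty$, with multiplication $(aa')(n)=\sum_{k\in\mathbb{Z}}a(k)\,\alpha^k(a'(n-k))$ and isometric involution $a^*(n)=\overline{\alpha^n(a(-n))}$; it is a unital Banach $*$-algebra. Elements are written $a=\sum_{n}f_n\delta^n$ with $f_n=a(n)\in C(X)$, where $\delta$ is the element with $\delta(1)=1$ and $\delta(m)=0$ for $m\neq1$; $C(X)$ embeds as $f\mapsto f\delta^0$, and $\delta f\delta^{-1}=\alpha(f)$, $\delta^*=\delta^{-1}$. All vector spaces are complex. A representation of an algebra $A$ on a vector space $E$ is a (not necessarily unital) homomorphism $\pi$ from $A$ to the algebra of linear operators on $E$; it is algebraically irreducible if $\pi(A)E\neq\{0\}$ and the only invariant subspaces are $\{0\}$ and $E$. Two representations are algebraically equivalent if there is an intertwining linear bijection between their spaces. A primitive ideal is the kernel of an algebraically irreducible representation; an ideal $I$ is selfadjoint if $I^*=I$. For $x\in\mathrm{Per}(\sigma)$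 of period $p$ and $\lambda\in\mathbb{T}$, $\pi_{x,\lambda}$ is the unique unital $*$-representation of $\ell^1(\Sigma)$ on a Hilbert space $H_{x,\lambda}$ with orthonormal basis $e_0,\dots,e_{p-1}$ such that $\pi_{x,\lambda}(f)e_j=f(\sigma^jx)e_j$ for $f\in C(X)$ and $0\le j\le p-1$, $\pi_{x,\lambda}(\delta)e_j=e_{j+1}$ for $0\le j\le p-2$, and $\pi_{x,\lambda}(\delta)e_{p-1}=\lambda e_0$. *)

(* Defs.v *)
From HB Require Import structures.
From mathcomp Require Import all_boot all_order all_algebra.
From mathcomp Require Import sesquilinear spectral finmap.
From mathcomp Require Import all_classical all_reals all_analysis.
From mathcomp Require Import complex.
From mathcomp Require Import zify.
Set Implicit Arguments. Unset Strict Implicit. Unset Printing Implicit Defensive.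
Import Order.TTheory GRing.Theory Num.Theory.
Import numFieldNormedType.Exports.
Import Normc.
Local Open Scope classical_set_scope.
Local Open Scope ring_scope.
Local Open Scope complex_scope.
Local Notation Re := (@complex.Re _).
Local Notation Im := (@complex.Im _).
Local Notation normc := (@Normc.normc _).

Section UnorderedSums.
Variables (R : realType) (T : choiceType).
Implicit Types (f g h : T -> R) (u v : T -> R[i]).

(* Unordered sum of an absolutely summable family of reals: the sum of the
   positive parts minus the sum of the negative parts. *)
Definition rsum f : R :=
  fine (\esum_(i in [set: T]) (Num.max (f i) 0)%:E) -
  fine (\esum_(i in [set: T]) (Num.max (- f i) 0)%:E).

Definition csum u : R[i] := rsum (Re \o u) +i* rsum (Im \o u).

Definition pos_summable f :=
  (forall i, 0 <= f i) /\ (\esum_(i in [set: T]) (f i)%:E < +oo)%E.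

Definition abs_summable u := pos_summable (normc \o u).

Definition psum f := fine (\esum_(i in [set: T]) (f i)%:E).

Lemma psumK f : pos_summable f ->
  (\esum_(i in [set: T]) (f i)%:E)%E = (psum f)%:E.
Proof.
move=> [f0 fs]; rewrite fineK// ge0_fin_numE//.
by apply: esum_ge0 => i _; rewrite lee_fin.
Qed.

Lemma psum_ge0 f : (forall i, 0 <= f i) -> 0 <= psum f.
Proof. by move=> f0; apply/fine_ge0/esum_ge0 => i _; rewrite lee_fin. Qed.

Lemma pos_summable_le f g : (forall i, 0 <= f i <= g i) -> pos_summable g ->
  pos_summable f.
Proof.
move=> fg [g0 gs]; split; first by move=> i; case/andP: (fg i).
by apply: le_lt_trans gs; apply: le_esum => i _; rewrite lee_fin; case/andP: (fg i).
Qed.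

Lemma le_psum f g : (forall i, 0 <= f i <= g i) -> pos_summable g ->
  psum f <= psum g.
Proof.
move=> fg gs; have fs := pos_summable_le fg gs.
rewrite -lee_fin -!psumK//.
by apply: le_esum => i _; rewrite lee_fin; case/andP: (fg i).
Qed.

Lemma pos_summableD f g : pos_summable f -> pos_summable g ->
  pos_summable (f \+ g).
Proof.
move=> fs gs; have [f0 _] := fs; have [g0 _] := gs; split.
  by move=> i /=; rewrite addr_ge0.
under eq_esum do rewrite EFinD.
rewrite esumD; try by move=> i _; rewrite lee_fin.
by rewrite !psumK// ltry.
Qed.

Lemma psumD f g : pos_summable f -> pos_summable g ->
  psum (f \+ g) = psum f + psum g.
Proof.
move=> fs gs; have [f0 _] := fs; have [g0 _] := gs.
apply: EFin_inj; rewrite EFinD -!psumK//; last exact: pos_summableD.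
under eq_esum do rewrite EFinD.
by rewrite esumD// => i _; rewrite lee_fin.
Qed.

Lemma psumZ_le f (c : R) : 0 <= c -> pos_summable f ->
  (\esum_(i in [set: T]) (c * f i)%:E <= c%:E * (psum f)%:E)%E.
Proof.
move=> c0 fs; rewrite /esum; apply: ge_ereal_sup => _ [F [finF _] <-].
rewrite fsbig_finite//= -psumK//.
under eq_bigr do rewrite EFinM.
rewrite -ge0_sume_distrr; last by move=> i _; rewrite lee_fin; case: fs.
rewrite -fsbig_finite//=; apply: lee_wpmul2l; first by rewrite lee_fin.
by apply: esum_ge; exists F; first by split.
Qed.

Lemma pos_summableZ f (c : R) : 0 <= c -> pos_summable f ->
  pos_summable (fun i => c * f i).
Proof.
move=> c0 fs; split; first by move=> i; apply: mulr_ge0 => //; case: fs.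
by apply: le_lt_trans (psumZ_le c0 fs) _; rewrite -EFinM ltry.
Qed.

Lemma psumZ f (c : R) : 0 <= c -> pos_summable f ->
  psum (fun i => c * f i) = c * psum f.
Proof.
move=> c0 fs; have cfs := pos_summableZ c0 fs.
apply/eqP; rewrite eq_le; apply/andP; split.
  by rewrite -lee_fin -psumK// EFinM; exact: psumZ_le.
have [->|cn0] := eqVneq c 0.
  by rewrite mul0r; apply: psum_ge0 => i; rewrite mul0r.
have cp : 0 < c by rewrite lt_neqAle eq_sym cn0.
rewrite -ler_pdivlMl// -lee_fin -psumK// EFinM.
have := @psumZ_le _ c^-1 _ cfs; rewrite invr_ge0 => /(_ c0); apply: le_trans.
by apply: le_esum => i _; rewrite mulKf.
Qed.

Lemma psum_le_sup f (F : set T) : finite_set F -> pos_summable f ->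
  \sum_(i \in F) f i <= psum f.
Proof.
move=> finF fs; rewrite -lee_fin -psumK//; apply: esum_ge; exists F; first by split.
by rewrite fsumEFin.
Qed.

Lemma rsum_diff f g h : pos_summable g -> pos_summable h -> f =1 g \- h ->
  rsum f = psum g - psum h.
Proof.
move=> gs hs fE; rewrite /rsum -/(psum (fun i => Num.max (f i) 0)).
rewrite -/(psum (fun i => Num.max (- f i) 0)).
have [g0 _] := gs; have [h0 _] := hs.
have ps : pos_summable (fun i => Num.max (f i) 0).
  apply: (pos_summable_le _ gs) => i; rewrite le_max lexx orbT ge_max g0 andbT.
  by rewrite fE lerBlDr lerDl h0.
have ns : pos_summable (fun i => Num.max (- f i) 0).
  apply: (pos_summable_le _ hs) => i; rewrite le_max lexx orbT ge_max h0 andbT.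
  by rewrite fE opprB lerBlDr lerDl g0.
apply/eqP; rewrite subr_eq addrAC eq_sym subr_eq -!psumD//.
apply/eqP; congr psum; apply/funext => i /=.
have -> : Num.max (f i) 0 = f i + Num.max (- f i) 0.
  by rewrite addr_maxr subrr addr0 maxC.
by rewrite fE addrC -addrA [_ + h i]addrC addrA subrK addrC.
Qed.

Lemma rsum_posneg f : pos_summable (fun i => `|f i|) ->
  [/\ pos_summable (fun i => Num.max (f i) 0),
      pos_summable (fun i => Num.max (- f i) 0) &
      f =1 (fun i => Num.max (f i) 0) \- (fun i => Num.max (- f i) 0)].
Proof.
move=> fs; split.
- apply: (pos_summable_le _ fs) => i.
  by rewrite le_max lexx orbT ge_max ler_norm normr_ge0.
- apply: (pos_summable_le _ fs) => i.
  by rewrite le_max lexx orbT ge_max -normrN ler_norm normr_ge0.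
- move=> i /=; have [fi|fi] := leP 0 (f i).
    by rewrite (max_idPr _) ?oppr_le0// subr0.
  by rewrite (max_idPl _) ?oppr_ge0 ?ltW// sub0r opprK.
Qed.

Lemma rsum_psum f : pos_summable f -> rsum f = psum f.
Proof.
move=> fs; have zs : pos_summable (fun _ : T => 0 : R).
  split=> //; rewrite esum1//.
rewrite (rsum_diff fs zs); last by move=> i /=; rewrite subr0.
by rewrite /psum [X in _ - fine X]esum1// subr0.
Qed.

Lemma abs_rsum_le f : pos_summable (fun i => `|f i|) ->
  `|rsum f| <= psum (fun i => `|f i|).
Proof.
move=> fs; have [ps ns fE] := rsum_posneg fs.
rewrite (rsum_diff ps ns fE).
have [p0 _] := ps; have [n0 _] := ns.
apply: le_trans (ler_normB _ _) _.
rewrite !ger0_norm; [|exact: psum_ge0..].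
rewrite -psumD//; apply: le_psum => // i /=; rewrite addr_ge0//=.
have [fi|fi] := leP 0 (f i).
  by rewrite (max_idPr _) ?oppr_le0// addr0 ger0_norm.
by rewrite (max_idPl _) ?oppr_ge0 ?(ltW fi)// add0r ltr0_norm.
Qed.

Lemma rsumD f g : pos_summable (fun i => `|f i|) ->
  pos_summable (fun i => `|g i|) -> rsum (f \+ g) = rsum f + rsum g.
Proof.
move=> /rsum_posneg [fp fn fE] /rsum_posneg [gp gn gE].
rewrite (rsum_diff (pos_summableD fp gp) (pos_summableD fn gn)).
  by rewrite !psumD// (rsum_diff fp fn fE) (rsum_diff gp gn gE) addrACA -opprD.
by move=> i /=; rewrite {1}fE {1}gE /= addrACA -opprD.
Qed.

Lemma rsumN f : rsum (\- f) = - rsum f.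
Proof. by rewrite /rsum opprB /=; under [in X in _ - X]eq_esum do rewrite opprK. Qed.

Lemma rsumZ f (c : R) : pos_summable (fun i => `|f i|) ->
  rsum (fun i => c * f i) = c * rsum f.
Proof.
have pos g (d : R) : 0 <= d -> pos_summable (fun i => `|g i|) ->
    rsum (fun i => d * g i) = d * rsum g.
  move=> d0 /rsum_posneg [gp gn gE].
  rewrite (rsum_diff (pos_summableZ d0 gp) (pos_summableZ d0 gn)); last first.
    by move=> i /=; rewrite {1}gE /= mulrBr.
  by rewrite !psumZ// (rsum_diff gp gn gE) mulrBr.
move=> fs; have [c0|c0] := leP 0 c; first exact: pos.
have -> : (fun i => c * f i) = (\- (fun i => - c * f i)).
  by apply/funext => i /=; rewrite mulNr opprK.
by rewrite rsumN pos ?oppr_ge0 ?ltW// mulNr opprK.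
Qed.

Lemma normc_ge0 (z : R[i]) : 0 <= normc z.
Proof. by case: z => a b; rewrite sqrtr_ge0. Qed.

Lemma normc_norm (z : R[i]) : `|z| = (normc z)%:C.
Proof. by case: z. Qed.

Lemma abs_Re_le (z : R[i]) : `|Re z| <= normc z.
Proof. by rewrite -lecR -normc_norm; exact: normc_ge_Re. Qed.

Lemma abs_Im_le (z : R[i]) : `|Im z| <= normc z.
Proof.
case: z => a b /=; rewrite -sqrtr_sqr ler_wsqrtr// lerDr sqr_ge0//.
Qed.

Lemma normc_le (z : R[i]) : normc z <= `|Re z| + `|Im z|.
Proof.
case: z => a b /=; rewrite -[leRHS]ger0_norm; last exact: addr_ge0.
rewrite -sqrtr_sqr ler_wsqrtr// sqrrD !real_normK ?num_real//.
by rewrite addrAC lerDl mulrn_wge0// mulr_ge0.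
Qed.

Lemma abs_summable_Re u : abs_summable u ->
  pos_summable (fun i => `|(Re \o u) i|).
Proof.
by move=> us; apply: (pos_summable_le _ us) => i; rewrite normr_ge0 abs_Re_le.
Qed.

Lemma abs_summable_Im u : abs_summable u ->
  pos_summable (fun i => `|(Im \o u) i|).
Proof.
by move=> us; apply: (pos_summable_le _ us) => i; rewrite normr_ge0 abs_Im_le.
Qed.

Lemma abs_summable_le u f : (forall i, normc (u i) <= f i) -> pos_summable f ->
  abs_summable u.
Proof. by move=> uf; apply: pos_summable_le => i; rewrite normc_ge0 uf. Qed.

Lemma abs_summableD u v : abs_summable u -> abs_summable v ->
  abs_summable (fun i => u i + v i).
Proof.
move=> us vs; apply: abs_summable_le (pos_summableD us vs) => i.
exact: le_normcD.
Qed.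

Lemma abs_summableZ u (c : R[i]) : abs_summable u ->
  abs_summable (fun i => c * u i).
Proof.
move=> us; apply: abs_summable_le (pos_summableZ (normc_ge0 c) us) => i.
by rewrite normcM.
Qed.

Lemma csumD u v : abs_summable u -> abs_summable v ->
  csum (fun i => u i + v i) = csum u + csum v.
Proof.
move=> us vs; rewrite /csum /=.
have -> : Re \o (fun i => u i + v i) = (Re \o u) \+ (Re \o v).
  by apply/funext => i /=; case: (u i) (v i) => [? ?] [? ?].
have -> : Im \o (fun i => u i + v i) = (Im \o u) \+ (Im \o v).
  by apply/funext => i /=; case: (u i) (v i) => [? ?] [? ?].
by rewrite !rsumD//; first [exact: abs_summable_Re|exact: abs_summable_Im].
Qed.

Lemma csumZ u (c : R[i]) : abs_summable u ->
  csum (fun i => c * u i) = c * csum u.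
Proof.
move=> us; have rs := abs_summable_Re us; have ms := abs_summable_Im us.
case: c => a b; rewrite /csum /=.
have sZ f (d : R) : pos_summable (fun i => `|f i|) ->
    pos_summable (fun i => `|d * f i|).
  move=> /(pos_summableZ (normr_ge0 d)) fs.
  by apply: (pos_summable_le _ fs) => i; rewrite normr_ge0 normrM lexx.
have -> : Re \o (fun i => (a +i* b) * u i) =
    (fun i => a * (Re \o u) i) \+ (fun i => (- b) * (Im \o u) i).
  by apply/funext => i /=; case: (u i) => [? ?] /=; rewrite mulNr.
have -> : Im \o (fun i => (a +i* b) * u i) =
    (fun i => a * (Im \o u) i) \+ (fun i => b * (Re \o u) i).
  by apply/funext => i /=; case: (u i) => [? ?] /=; rewrite [b * _]mulrC.
rewrite !rsumD; [|exact: sZ..].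
rewrite !rsumZ//; simpc.
by [].
Qed.

Lemma csumZr u (c : R[i]) : abs_summable u ->
  csum (fun i => u i * c) = csum u * c.
Proof.
by move=> us; rewrite mulrC -csumZ//; congr csum; apply/funext => i; rewrite mulrC.
Qed.

Lemma csum_conj u : csum (fun i => (u i)^*) = (csum u)^*.
Proof.
rewrite /csum /= -rsumN; congr (_ +i* _); congr rsum; apply/funext => i /=;
  by case: (u i).
Qed.

Lemma normc_csum_le u : abs_summable u ->
  normc (csum u) <= psum (normc \o u) *+ 2.
Proof.
move=> us; apply: le_trans (normc_le _) _; rewrite /csum /= mulr2n.
apply: lerD.
- apply: le_trans (abs_rsum_le (abs_summable_Re us)) _.
  by apply: le_psum => // i; rewrite normr_ge0 abs_Re_le.
- apply: le_trans (abs_rsum_le (abs_summable_Im us)) _.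
  by apply: le_psum => // i; rewrite normr_ge0 abs_Im_le.
Qed.

Lemma csum0 : csum (fun=> 0) = 0.
Proof.
rewrite /csum -[0 in RHS]complexr0; rewrite /rsum /=.
by rewrite !esum1 ?subrr// => i _; rewrite ?oppr0 maxxx.
Qed.

Lemma abs_summable0 : abs_summable (fun=> 0).
Proof.
split=> [i|]; first exact: normc_ge0.
by rewrite esum1// => i _; rewrite /comp normc0.
Qed.

Lemma abs_summable1 u t : (forall i, i != t -> u i = 0) -> abs_summable u.
Proof.
move=> ut; split=> [i|]; first exact: normc_ge0.
rewrite (esumID [set t]); last by move=> i _; rewrite lee_fin normc_ge0.
rewrite setTI esum_set1 ?lee_fin ?normc_ge0// esum1 ?adde0 ?ltry// => i /=.
by move=> [_ /eqP it]; rewrite ut// normc0.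
Qed.

Lemma csum1 u t : (forall i, i != t -> u i = 0) -> csum u = u t.
Proof.
have rs f : (forall i, i != t -> f i = 0) -> rsum f = f t.
  have es g : (forall i, 0 <= g i) -> (forall i, i != t -> g i = 0) ->
      (\esum_(i in [set: T]) (g i)%:E)%E = (g t)%:E.
    move=> g0 gt; rewrite (esumID [set t]); last by move=> i _; rewrite lee_fin.
    rewrite setTI esum_set1 ?lee_fin// esum1 ?adde0// => i /=.
    by move=> [_ /eqP it]; rewrite gt.
  move=> ft; rewrite /rsum !es/=.
  - have [fi|fi] := leP 0 (f t).
      by rewrite (max_idPr _) ?oppr_le0// subr0.
    by rewrite (max_idPl _) ?oppr_ge0 ?ltW// sub0r opprK.
  - by move=> i; rewrite le_max lexx orbT.
  - by move=> i /ft ->; rewrite oppr0 maxxx.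
  - by move=> i; rewrite le_max lexx orbT.
  - by move=> i /ft ->; rewrite maxxx.
move=> ut; rewrite /csum !rs /=; first by case: (u t).
- by move=> i /ut /= ->.
- by move=> i /ut /= ->.
Qed.

Lemma csum_sum n (w : 'I_n -> T -> R[i]) :
  (forall r, abs_summable (w r)) ->
  abs_summable (fun i => \sum_(r < n) w r i) /\
  csum (fun i => \sum_(r < n) w r i) = \sum_(r < n) csum (w r).
Proof.
elim: n w => [|n IHn] w ws.
  rewrite big_ord0.
  have -> : (fun i => \sum_(r < 0) w r i) = (fun=> 0).
    by apply/funext => i; rewrite big_ord0.
  by split; [exact: abs_summable0|exact: csum0].
have -> : (fun i => \sum_(r < n.+1) w r i) =
    (fun i => w ord0 i + \sum_(r < n) w (lift ord0 r) i).
  by apply/funext => i; rewrite big_ord_recl.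
have [sw cw] := IHn (fun r => w (lift ord0 r)) (fun r => ws _).
by split; [exact: abs_summableD|rewrite csumD// big_ord_recl cw].
Qed.

End UnorderedSums.

Section Fubini.
Variable R : realType.

Lemma psum_slices (T1 T2 : choiceType) (f : T1 -> T2 -> R) :
    (forall i j, 0 <= f i j) ->
    pos_summable (fun k => f k.1 k.2) <->
    (forall i, pos_summable (f i)) /\ pos_summable (fun i => psum (f i)).
Proof.
move=> f0.
have E : (\esum_(i in [set: T1]) \esum_(j in [set: T2]) (f i j)%:E =
          \esum_(k in [set: T1 * T2]) (f k.1 k.2)%:E)%E.
  rewrite esum_esum; last by move=> i j _ _; rewrite lee_fin.
  by congr esum; apply/seteqP; split=> -[].
split=> [[_]|[fs [ps0 pss]]]; last first.
  split=> [k|]; first exact: f0.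
  rewrite -E; apply: le_lt_trans pss; apply: le_esum => i _.
  by rewrite psumK.
rewrite -E => foo.
have es0 i : (0 <= \esum_(j in [set: T2]) (f i j)%:E)%E.
  by apply: esum_ge0 => j _; rewrite lee_fin.
have fs i : pos_summable (f i).
  split=> //; apply: le_lt_trans foo.
  rewrite (esumID [set i]); last by move=> ? _; exact: es0.
  rewrite setTI esum_set1// leeDl// esum_ge0//.
split=> //; split=> [i|]; first exact: psum_ge0.
by apply: le_lt_trans foo; apply: le_esum => i _; rewrite psumK.
Qed.

Lemma psum_pair (T1 T2 : choiceType) (f : T1 -> T2 -> R) :
  pos_summable (fun k => f k.1 k.2) ->
  psum (fun k => f k.1 k.2) = psum (fun i => psum (f i)).
Proof.
move=> fs; have f0 i j : 0 <= f i j by case: fs => /(_ (i, j)).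
have [ss ps] := (psum_slices f0).1 fs.
apply: EFin_inj; rewrite -!psumK//.
under [RHS]eq_esum do rewrite -psumK//.
rewrite esum_esum; last by move=> i j _ _; rewrite lee_fin.
by congr esum; apply/seteqP; split=> -[].
Qed.

Lemma rsum_pair (T1 T2 : choiceType) (f : T1 -> T2 -> R) :
  pos_summable (fun k => `|f k.1 k.2|) ->
  rsum (fun k => f k.1 k.2) = rsum (fun i => rsum (f i)).
Proof.
move=> fs; have [ps ns fE] := rsum_posneg fs.
rewrite (rsum_diff ps ns fE).
pose p i j := Num.max (f i j) 0; pose n i j := Num.max (- f i j) 0.
rewrite -/(psum (fun k => p k.1 k.2)) -/(psum (fun k => n k.1 k.2)).
have p0 i j : 0 <= p i j by rewrite le_max lexx orbT.
have n0 i j : 0 <= n i j by rewrite le_max lexx orbT.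
have [sp pp] := (psum_slices p0).1 ps.
have [sn pn] := (psum_slices n0).1 ns.
rewrite (@psum_pair _ _ p)// (@psum_pair _ _ n)//; apply/esym.
by apply: rsum_diff.

Qed.

Lemma abs_summable_pair (T1 T2 : choiceType) (w : T1 -> T2 -> R[i]) :
  abs_summable (fun k => w k.1 k.2) ->
  (forall i, abs_summable (w i)) /\ abs_summable (fun i => csum (w i)).
Proof.
move=> ws; have n0 i j : 0 <= normc (w i j) by exact: normc_ge0.
have [ss sp] := (psum_slices n0).1 ws; split=> //.
have s2 := pos_summableZ (ler0n R 2) sp.
apply: (abs_summable_le _ s2) => i.
by rewrite mulr_natl; exact: normc_csum_le (ss i).
Qed.

Lemma csum_pair (T1 T2 : choiceType) (w : T1 -> T2 -> R[i]) :
  abs_summable (fun k => w k.1 k.2) ->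
  csum (fun k => w k.1 k.2) = csum (fun i => csum (w i)).
Proof.
move=> ws; rewrite /csum.
have := @rsum_pair _ _ (fun i j => Re (w i j)) (abs_summable_Re ws).
have := @rsum_pair _ _ (fun i j => Im (w i j)) (abs_summable_Im ws).
by rewrite /comp /= => -> ->.
Qed.

Lemma pos_summable_reindex (T T' : choiceType) (e : T -> T') (f : T' -> R) :
  bijective e -> pos_summable f -> pos_summable (f \o e).
Proof.
move=> be [f0 fs]; split=> [i|]; first exact: f0.
move: fs; rewrite (@reindex_esum _ _ _ [set: T] [set: T'] e)//.
by rewrite setTT_bijective.
Qed.

Lemma abs_summable_reindex (T T' : choiceType) (e : T -> T') (u : T' -> R[i]) :
  bijective e -> abs_summable u -> abs_summable (u \o e).
Proof. by move=> be us; exact: (pos_summable_reindex be us). Qed.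

Lemma csum_reindex (T T' : choiceType) (e : T -> T') (u : T' -> R[i]) :
  bijective e -> csum (u \o e) = csum u.
Proof.
move=> be; have bT : set_bij [set: T] [set: T'] e by rewrite setTT_bijective.
by rewrite /csum /rsum !(@reindex_esum _ _ _ _ _ _ _ bT).
Qed.

Lemma pos_summable_mul (T1 T2 : choiceType) (f : T1 -> R) (g : T2 -> R) :
  pos_summable f -> pos_summable g -> pos_summable (fun k => f k.1 * g k.2).
Proof.
move=> fs gs; have [f0 _] := fs; have [g0 _] := gs.
apply: (@psum_slices _ _ (fun i j => f i * g j) _).2.
  by move=> i j; rewrite mulr_ge0.
split=> [i|]; first exact: pos_summableZ.
under eq_fun do rewrite psumZ// mulrC.
by apply: pos_summableZ => //; exact: psum_ge0.
Qed.

Lemma abs_summable_mul (T1 T2 : choiceType) (u : T1 -> R[i]) (v : T2 -> R[i]) :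
  abs_summable u -> abs_summable v -> abs_summable (fun k => u k.1 * v k.2).
Proof.
move=> us vs; apply: abs_summable_le (pos_summable_mul us vs) => k.
by rewrite normcM.
Qed.

Lemma csum_mul (T1 T2 : choiceType) (u : T1 -> R[i]) (v : T2 -> R[i]) :
  abs_summable u -> abs_summable v ->
  csum u * csum v = csum (fun k => u k.1 * v k.2).
Proof.
move=> us vs.
rewrite (@csum_pair _ _ (fun i j => u i * v j)); last exact: abs_summable_mul.
by rewrite -csumZr//; congr csum; apply/funext => i; rewrite csumZ.
Qed.

End Fubini.

Lemma continuous_mulC (K : numFieldType) (X : topologicalType) (f g : X -> K) :
  continuous (f : X -> K^o) -> continuous (g : X -> K^o) ->
  continuous ((fun x => f x * g x) : X -> K^o).
Proof. by move=> fc gc x; apply: cvgM; [exact: fc|exact: gc]. Qed.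

Lemma continuous_sumC (K : numFieldType) (X : topologicalType) (T : Type)
    (u : T -> X -> K) (s : seq T) :
  (forall k, continuous (u k : X -> K^o)) ->
  continuous ((fun x => \sum_(k <- s) u k x) : X -> K^o).
Proof.
move=> uc; elim: s => [|k s IHs] x.
  have -> : (fun y => \sum_(k <- [::]) u k y) = (fun=> 0 : K^o).
    by apply/funext => y; rewrite big_nil.
  exact: cvg_cst.
have -> : (fun y => \sum_(i <- k :: s) u i y) =
    (fun y => u k y + \sum_(i <- s) u i y : K^o).
  by apply/funext => y; rewrite big_cons.
by apply: cvgD; [exact: uc|exact: IHs].
Qed.

Section Continuity.
Variables (R : realType) (T : choiceType).

Lemma csum_seq (u : T -> R[i]) (s : seq T) : uniq s -> abs_summable u ->
  abs_summable (fun k => if k \in s then 0 else u k) /\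
  csum u = \sum_(k <- s) u k + csum (fun k => if k \in s then 0 else u k).
Proof.
move=> us su; elim: s us => [_|a s IHs /= /andP[as_ us]].
  by rewrite big_nil add0r.
have [ss ->] := IHs us.
have st : abs_summable (fun k => if k \in a :: s then 0 else u k).
  apply: (abs_summable_le _ su) => k; case: ifP => // _.
  by rewrite normc0 normc_ge0.
split=> //; rewrite big_cons -addrA addrCA; congr (_ + _).
pose d k := if k == a then u k else 0.
have da k : k != a -> d k = 0 by rewrite /d => /negbTE ->.
rewrite -[u a]/(u a) (_ : u a = d a); last by rewrite /d eqxx.
rewrite -(csum1 da) -csumD//; last exact: (abs_summable1 da).
congr csum; apply/funext => k; rewrite /d inE.
have [->|ka] := eqVneq k a; first by rewrite (negbTE as_) addr0.
by rewrite add0r.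
Qed.

Lemma csum_pos (M : T -> R) : pos_summable M ->
  csum (fun k => (M k)%:C) = (psum M)%:C.
Proof.
move=> Ms; rewrite /csum.
have -> : Re \o (fun k => (M k)%:C) = M by apply/funext.
rewrite rsum_psum//.
have -> : Im \o (fun k => (M k)%:C) = (fun=> 0) by apply/funext.
have /(congr1 (@complex.Im _)) := @csum0 R T; rewrite /csum /= => h.
by rewrite (_ : Im \o _ = (fun=> 0)) // in h; rewrite h.
Qed.

Lemma psum_tail (M : T -> R) (e : R) : 0 < e -> pos_summable M ->
  exists s : seq T, [/\ uniq s,
    pos_summable (fun k => if k \in s then 0 else M k) &
    psum (fun k => if k \in s then 0 else M k) < e].
Proof.
move=> e0 Ms; have [M0 _] := Ms.
have : ((psum M - e)%:E < \esum_(k in [set: T]) (M k)%:E)%E.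
  by rewrite psumK// lte_fin gtrBl.
rewrite /esum => /ereal_sup_gt [_ [F [finF _] <-]].
rewrite fsbig_finite//= sumEFin lte_fin => Fe.
exists (finmap.enum_fset (fset_set F)); have uF := finmap.fset_uniq (fset_set F).
have ts : pos_summable (fun k => if k \in finmap.enum_fset (fset_set F) then 0 else M k).
  apply: (pos_summable_le _ Ms) => k.
  by case: ifP => _; rewrite ?lexx ?M0.
split=> //.
have MC : abs_summable (fun k => (M k)%:C).
  apply: (abs_summable_le _ Ms) => k.
  by rewrite -lecR -normc_norm ger0_norm ?ler0c.
have [_] := csum_seq uF MC.
rewrite csum_pos//.
have -> : (fun k => if k \in finmap.enum_fset (fset_set F) then 0 else (M k)%:C) =
    (fun k => (if k \in finmap.enum_fset (fset_set F) then 0 else M k)%:C).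
  by apply/funext => k; case: ifP.
rewrite csum_pos// -rmorph_sum -rmorphD => /complexI MF.
by move: Fe; rewrite MF ltrBlDr ltrD2l.
Qed.

Lemma continuous_csum (X : topologicalType) (u : T -> X -> R[i]) (M : T -> R) :
  pos_summable M -> (forall k x, normc (u k x) <= M k) ->
  (forall k, continuous (u k : X -> R[i]^o)) ->
  continuous ((fun x => csum (fun k => u k x)) : X -> R[i]^o).
Proof.
move=> Ms uM uc x; apply/cvgrPdist_lt => eps eps0.
have [e e0 ->] : exists2 e : R, 0 < e & eps = (e * 8)%:C.
  exists (complex.Re eps / 8).
    by move: eps0; rewrite ltcE/= => /andP[_ ?]; rewrite divr_gt0.
  rewrite divfK ?pnatr_eq0//; case: eps eps0 => a b; rewrite ltcE/=.
  by move=> /andP[/eqP -> _].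
have [s [us ts te]] := psum_tail e0 Ms.
have su y : abs_summable (u ^~ y) by exact: abs_summable_le Ms.
pose tl y := csum (fun k => if k \in s then 0 else u k y).
have tlE y : csum (u ^~ y) = \sum_(k <- s) u k y + tl y.
  by have [_] := csum_seq us (su y).
have tlb y : normc (tl y) < e *+ 2.
  have [ss _] := csum_seq us (su y).
  apply: le_lt_trans (normc_csum_le ss) _.
  rewrite ltrMn2r//=; apply: le_lt_trans te.
  apply: le_psum => // k /=; rewrite normc_ge0/=.
  by case: ifP => _; rewrite ?normc0 ?uM.
have sc : {for x, continuous ((fun y => \sum_(k <- s) u k y) : X -> R[i]^o)}.
  exact: continuous_sumC uc x.
have e2 : 0 < e%:C :> R[i] by rewrite ltcR.
near=> y; rewrite !tlE.
have : `|\sum_(k <- s) u k x - \sum_(k <- s) u k y| < e%:C.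
  by near: y; move/cvgrPdist_lt : sc; apply.
rewrite !normc_norm !ltcR => sxy.
rewrite opprD addrACA; apply: le_lt_trans (le_normcD _ _) _.
have : normc (tl x - tl y) < e *+ 4.
  apply: le_lt_trans (le_normcD _ _) _; rewrite normcN.
  by rewrite -[4%N]/(2 + 2)%N mulrnDr ltrD.
move=> txy; apply: lt_trans (ltrD sxy txy) _.
by rewrite -mulrS mulr_natr ltr_pMn2l.
Unshelve. all: by end_near. Qed.

End Continuity.

Record dynSystem := DynSystem {
  dspace :> topologicalType;
  homeo : dspace -> dspace;
  homeoV : dspace -> dspace;
  homeoK : cancel homeo homeoV;
  homeoVK : cancel homeoV homeo;
  homeo_continuous : continuous homeo;
  homeoV_continuous : continuous homeoV;
  dspace_compact : compact [set: dspace];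
  dspace_hausdorff : hausdorff_space dspace;
  dspace_nonempty : [set: dspace] !=set0
}.

Section Action.
Variable S : dynSystem.
Implicit Types (x y : S) (n m : int).

Definition iterZ n x : S :=
  match n with
  | Posz k => iter k (@homeo S) x
  | Negz k => iter k.+1 (@homeoV S) x
  end.

Definition orbitZ x : set S := [set iterZ n x | n in [set: int]].

Definition Per : set S := [set x | finite_set (orbitZ x)].

(* [fset_set] of an infinite set is empty, so a point with infinite orbit gets
   period 0. *)
Definition period x : nat := #|` fset_set (orbitZ x)|%fset.

Definition finite_orbits : set (set S) := [set orbitZ x | x in Per].

Lemma iterZ_suc n x : iterZ (n + 1) x = homeo (iterZ n x).
Proof.
case: n => [k|k]; first by rewrite -PoszD addn1.
have -> : Negz k + 1 = - k%:Z by rewrite NegzE -addn1 PoszD opprD addrNK.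
by case: k => [|k]; rewrite ?oppr0 -?NegzE /= homeoVK.
Qed.

Lemma iterZ_pred n x : iterZ (n - 1) x = homeoV (iterZ n x).
Proof. by rewrite -{2}[n](subrK 1) iterZ_suc homeoK. Qed.

Lemma iterZ0 x : iterZ 0 x = x. Proof. by []. Qed.

Lemma iterZD n m x : iterZ (n + m) x = iterZ n (iterZ m x).
Proof.
elim/int_rect: n => [|n IHn|n IHn]; first by rewrite add0r.
- by rewrite -addn1 PoszD addrAC !iterZ_suc IHn.
- by rewrite -addn1 PoszD opprD addrAC !iterZ_pred IHn.
Qed.

Lemma iterZK n x : iterZ (- n) (iterZ n x) = x.
Proof. by rewrite -iterZD addNr. Qed.

Lemma iterZVK n x : iterZ n (iterZ (- n) x) = x.
Proof. by rewrite -iterZD subrr. Qed.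

Lemma iterZ_continuous n : continuous (iterZ n).
Proof.
case: n => k; rewrite /iterZ.
- elim: k => [|k IHk] x; first exact: cvg_id.
  by apply: (continuous_comp (IHk x)); exact: homeo_continuous.
- elim: k => [|k IHk] x; first exact: homeoV_continuous.
  by apply: (continuous_comp (IHk x)); exact: homeoV_continuous.
Qed.

Lemma orbitZ_refl x : orbitZ x x.
Proof. by exists 0. Qed.

Lemma iterZ_mod x (d : nat) n : iterZ d x = x -> iterZ n x = iterZ (n %% d)%Z x.
Proof.
move=> dx; have dm m : iterZ (m * d%:Z) x = x.
  elim/int_rect: m => [|m IHm|m IHm]; first by rewrite mul0r.
  - by rewrite -addn1 PoszD mulrDl mul1r iterZD dx IHm.
  - rewrite -addn1 PoszD opprD mulrDl mulN1r iterZD.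
    by rewrite -[X in iterZ (- d%:Z) X]dx iterZK IHm.
by rewrite {1}(divz_eq n d) addrC iterZD dm.
Qed.

Lemma iterZ_period x : Per x -> (0 < period x)%N /\ iterZ (period x) x = x.
Proof.
move=> px; pose p := period x.
have memo n : iterZ n x \in fset_set (orbitZ x).
  by rewrite in_fset_set// inE; exists n.
have p0 : (0 < p)%N.
  by rewrite cardfs_gt0; apply/fset0Pn; exists x; exact: (memo 0).
split=> //.
have [i [j [ij jp ijx]]] : exists i j : nat,
    [/\ (i < j)%N, (j <= p)%N & iterZ i x = iterZ j x].
  pose s := [seq iterZ (k : nat) x | k <- iota 0 p.+1].
  have /negP : ~ uniq s.
    move=> us; suff : (size s <= p)%N by rewrite size_map size_iota ltnn.
    apply: uniq_leq_size => // y /mapP[k _ ->]; exact: memo.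
  move=> /(uniqPn x)[i [j [ij]]]; rewrite size_map size_iota => jp.
  rewrite !(nth_map 0%N) ?size_iota//; last exact: ltn_trans ij _.
  rewrite !nth_iota ?add0n//; last exact: ltn_trans ij _.
  by move=> h; exists i, j.
have dx : iterZ (j - i)%N x = x.
  by rewrite -subzn ?(ltnW ij)// addrC iterZD -ijx iterZK.
have di : (0 < j - i)%N by rewrite subn_gt0.
have : (p <= j - i)%N.
  suff /uniq_leq_size : {subset fset_set (orbitZ x) <=
      [seq iterZ (k : nat) x | k <- iota 0 (j - i)]}.
    by move=> /(_ (finmap.fset_uniq _)); rewrite size_map size_iota.
  move=> y; rewrite in_fset_set// inE => -[n _ <-].
  rewrite (iterZ_mod _ dx).
  have r0 : (0 <= n %% (j - i)%N)%Z by rewrite modz_ge0// -lt0n.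
  have rl : (n %% (j - i)%N < (j - i)%N)%Z by rewrite ltz_pmod.
  case: (_ %% _)%Z r0 rl => // r _ rl; apply/mapP; exists r => //.
  by rewrite mem_iota.
move=> pd; have jE : (j - i = p)%N by apply/eqP; rewrite eqn_leq pd leq_subLR (leq_trans jp) ?leq_addl.
by rewrite -/p -jE.
Qed.

End Action.

Arguments Per S : clear implicits.

Section Ell1.
Variables (R : realType) (S : dynSystem).
Implicit Types (f : S -> R[i]) (x : S).

(* The supremum norm and the l1-norm are taken in [\bar R]; both are finite on
   the functions of interest. *)
Definition supnorm f : \bar R :=
  ereal_sup [set (normc (f x))%:E | x in [set: S]].

Definition l1norm (a : int -> S -> R[i]) : \bar R :=
  \esum_(n in [set: int]) supnorm (a n).

Definition in_ell1 : {pred int -> S -> R[i]} :=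
  fun a => `[< (forall n, continuous (a n : S -> R[i]^o)) /\
               (l1norm a < +oo)%E >].

Record ell1 := Ell1 { ell1_fun :> int -> S -> R[i]; _ : ell1_fun \in in_ell1 }.

HB.instance Definition _ := [isSub for ell1_fun].
HB.instance Definition _ := [Choice of ell1 by <:].

Lemma supnorm_ge0 f : (0 <= supnorm f)%E.
Proof.
have [x _] := dspace_nonempty S.
apply: (@le_trans _ _ (normc (f x))%:E); first by rewrite lee_fin normc_ge0.
by apply: ereal_sup_ubound; exists x.
Qed.

Lemma in_ell1P (a : int -> S -> R[i]) :
  (a \in in_ell1) <-> (forall n, continuous (a n : S -> R[i]^o)) /\
    exists2 M : int -> R, pos_summable M & forall n x, normc (a n x) <= M n.
Proof.
split=> [/asboolP[ac al]|[ac [M Ms aM]]].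
  split=> //; exists (fun n => fine (supnorm (a n))).
    have fs n : (fine (supnorm (a n)))%:E = supnorm (a n).
      rewrite fineK// ge0_fin_numE ?supnorm_ge0//.
      apply: le_lt_trans al; rewrite /l1norm (esumID [set n]); last first.
        by move=> ? _; exact: supnorm_ge0.
      rewrite setTI esum_set1 ?supnorm_ge0// leeDl// esum_ge0// => ? _.
      exact: supnorm_ge0.
    split=> [n|]; first exact/fine_ge0/supnorm_ge0.
    by under eq_esum do rewrite fs.
  move=> n x; rewrite -lee_fin fineK; first by apply: ereal_sup_ubound; exists x.
  rewrite ge0_fin_numE ?supnorm_ge0//.
  apply: le_lt_trans al; rewrite /l1norm (esumID [set n]); last first.
    by move=> ? _; exact: supnorm_ge0.
  rewrite setTI esum_set1 ?supnorm_ge0// leeDl// esum_ge0// => ? _.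
  exact: supnorm_ge0.
apply/asboolP; split=> //; case: Ms => _; apply: le_lt_trans.
apply: le_esum => n _; apply: ge_ereal_sup => _ [x _ <-].
by rewrite lee_fin.
Qed.

Lemma ell1_submod : GRing.submod_closed in_ell1.
Proof.
split=> [|c a b /in_ell1P[ac [A As aA]] /in_ell1P[bc [B Bs bB]]]; apply/in_ell1P.
  split; first by move=> n x; exact: cvg_cst.
  exists (fun=> 0); first by split=> //; rewrite esum1.
  by move=> n x; rewrite normc0.
split.
  move=> n x; apply: (@cvgD _ R[i]^o); last exact: bc.
  by apply: (@cvgZr _ R[i]^o); exact: ac.
exists (fun n => normc c * A n + B n).
  by apply: pos_summableD => //; apply: pos_summableZ => //; exact: normc_ge0.
move=> n x; apply: le_trans (le_normcD _ _) _; apply: lerD => //.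
by rewrite normcM ler_wpM2l ?normc_ge0.
Qed.

HB.instance Definition _ := GRing.isSubmodClosed.Build _ _ in_ell1 ell1_submod.
HB.instance Definition _ := [SubChoice_isSubLmodule of ell1 by <:].

Lemma ell1_eqP (a b : ell1) : (forall n x, a n x = b n x) -> a = b.
Proof. by move=> ab; apply/val_inj/funext => n; apply/funext => x; exact: ab. Qed.

Lemma ell1_continuous (a : ell1) n : continuous (a n : S -> R[i]^o).
Proof. by case: a => a /= /in_ell1P[]. Qed.

Lemma ell1_bound (a : ell1) :
  exists2 M : int -> R, pos_summable M & forall n x, normc (a n x) <= M n.
Proof. by case: a => a /= /in_ell1P[]. Qed.

(* alpha^k(f) = f \o sigma^(-k). *)
Definition mul_fun (a b : int -> S -> R[i]) (n : int) (x : S) : R[i] :=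
  csum (fun k : int => a k x * b (n - k) (iterZ (- k) x)).

Lemma conv_bij : bijective (fun k : int * int => (k.2, k.1 - k.2)).
Proof.
exists (fun k => (k.1 + k.2, k.1)) => -[i j] /=; first by rewrite addrC subrK.
by rewrite addrAC subrr add0r.
Qed.

Lemma conv_summable (A B : int -> R) : pos_summable A -> pos_summable B ->
  (forall n, pos_summable (fun k => A k * B (n - k))) /\
  pos_summable (fun n => psum (fun k => A k * B (n - k))).
Proof.
move=> As Bs; have ABs := pos_summable_mul As Bs.
apply: (@psum_slices _ _ _ (fun n k => A k * B (n - k)) _).1.
  by move=> n k; rewrite mulr_ge0//; [case: As|case: Bs].
exact: (pos_summable_reindex conv_bij ABs).
Qed.

Lemma mul_summable (a b : ell1) n x :
  abs_summable (fun k : int => a k x * b (n - k) (iterZ (- k) x)).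
Proof.
have [A As aA] := ell1_bound a; have [B Bs bB] := ell1_bound b.
have [ss _] := conv_summable As Bs.
apply: abs_summable_le (ss n) => k; rewrite normcM.
by rewrite ler_pM ?normc_ge0.
Qed.

Lemma mul_subproof (a b : ell1) : mul_fun a b \in in_ell1.
Proof.
have [A As aA] := ell1_bound a; have [B Bs bB] := ell1_bound b.
have [ss sp] := conv_summable As Bs.
have ab n k x : normc (a k x * b (n - k) (iterZ (- k) x)) <= A k * B (n - k).
  by rewrite normcM ler_pM ?normc_ge0.
apply/in_ell1P; split=> [n|].
  apply: (continuous_csum (ss n)) => // k.
  apply: continuous_mulC; first exact: ell1_continuous.
  move=> x.
  apply: (@continuous_comp _ _ R[i]^o (iterZ (- k)) (b (n - k))).
    exact: iterZ_continuous.
  exact: (@ell1_continuous b).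
exists (fun n => 2 * psum (fun k => A k * B (n - k))).
  exact: pos_summableZ.
move=> n x; apply: le_trans (normc_csum_le (mul_summable a b n x)) _.
rewrite mulr_natl lerMn2r/=; apply: le_psum => // k /=.
by rewrite normc_ge0 ab.
Qed.

Definition mul_ell1 (a b : ell1) : ell1 := Ell1 (mul_subproof a b).

Lemma monom_in_ell1 (g : S -> R[i]) (m : int) :
  continuous (g : S -> R[i]^o) ->
  (fun n x => if n == m then g x else 0) \in in_ell1.
Proof.
move=> gc; apply/in_ell1P; split=> [n|].
  by have [_|_] := eqVneq n m; [exact: gc|move=> x; exact: cvg_cst].
have [C gC] : exists C, forall x, normc (g x) <= C.
  pose h x : R := normc (g x).
  have hc : continuous h.
    move=> x; apply/cvgrPdist_lt => e e0.
    have e0' : 0 < e%:C :> R[i] by rewrite ltcR.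
    move/cvgrPdist_lt : (gc x) => /(_ _ e0'); apply: filterS => y.
    rewrite normc_norm ltcR; apply: le_lt_trans.
    rewrite /h ler_norml; apply/andP; split.
      rewrite lerBrDr addrC lerBlDr -[normc (g x - _)]normcN opprB.
      by rewrite -{1}[g y](subrK (g x)) addrC le_normcD.
    by rewrite lerBlDr -{1}[g x](subrK (g y)) le_normcD.
  have hcmp : compact (h @` [set: S]).
    apply: (@continuous_compact _ _ h); last exact: dspace_compact.
    exact: continuous_subspaceT.
  have [N [_ hN]] := @compact_bounded R R^o _ hcmp.
  exists (N + 1) => x.
  have Nr : N < N + 1 by rewrite ltrDl.
  apply: le_trans (hN _ Nr (h x) _); first exact: ler_norm.
  by exists x.
exists (fun n => if n == m then Num.max C 0 else 0).
  split=> [n|]; first by case: ifP => _ //; rewrite le_max lexx orbT.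
  rewrite (esumID [set m]); last first.
    by move=> n _; case: ifP => _ //; rewrite lee_fin le_max lexx orbT.
  rewrite setTI esum_set1 ?eqxx ?lee_fin ?le_max ?lexx ?orbT//.
  by rewrite esum1 ?adde0 ?ltry// => n /= [_ /eqP/negbTE ->].
move=> n x; case: ifP => _; last by rewrite normc0.
by rewrite le_max gC.
Qed.

(* [monom gc m] is g delta^m. *)
Definition monom (g : S -> R[i]) (gc : continuous (g : S -> R[i]^o)) (m : int)
  : ell1 := Ell1 (monom_in_ell1 m gc).

Definition one_ell1 : ell1 := monom (@cst_continuous S R[i]^o 1) 0.

Lemma mul_ell1A : associative mul_ell1.
Proof.
move=> a b c; apply: ell1_eqP => n x /=; rewrite /mul_fun /=.
pose F (j m : int) := a j x * (b m (iterZ (- j) x) *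
  c (n - j - m) (iterZ (- m) (iterZ (- j) x))).
have Fs : abs_summable (fun k => F k.1 k.2).
  have [A As aA] := ell1_bound a; have [B Bs bB] := ell1_bound b.
  have [C Cs cC] := ell1_bound c.
  have Cb m y : normc (c m y) <= psum C.
    apply: le_trans (cC m y) _.
    have := psum_le_sup (finite_set1 m) Cs.
    by rewrite fsbig_set1.
  have C0 : 0 <= psum C by apply: psum_ge0; case: Cs.
  have ABC := pos_summableZ C0 (pos_summable_mul As Bs).
  apply: abs_summable_le ABC => -[j m] /=.
  rewrite /F !normcM mulrA [leRHS]mulrC.
  by rewrite ler_pM ?mulr_ge0 ?normc_ge0// ler_pM ?normc_ge0.
transitivity (csum (fun j => csum (F j))).
  congr csum; apply/funext => j; rewrite -csumZ//.
  have := mul_summable b c (n - j) (iterZ (- j) x); exact.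
rewrite -csum_pair// -(csum_reindex _ conv_bij).
pose G (k j : int) := F j (k - j).
rewrite -[LHS]/(csum (fun k => G k.1 k.2)) csum_pair; last first.
  exact: (abs_summable_reindex conv_bij Fs).
congr csum; apply/funext => k; rewrite -csumZr; last exact: mul_summable.
congr csum; apply/funext => j; rewrite /G /F mulrA; congr (_ * c _ _).
  by rewrite opprB addrA subrK.
by rewrite -iterZD opprB addrAC subrr add0r.
Qed.

Lemma mul_ell11 : left_id one_ell1 mul_ell1.
Proof.
move=> a; apply: ell1_eqP => n x /=; rewrite /mul_fun /=.
rewrite (@csum1 _ _ _ (0 : int)); first by rewrite eqxx mul1r subr0.
by move=> k /negbTE ->; rewrite mul0r.
Qed.

Lemma mul_ell1r : right_id one_ell1 mul_ell1.
Proof.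
move=> a; apply: ell1_eqP => n x /=; rewrite /mul_fun /=.
rewrite (@csum1 _ _ _ n); first by rewrite subrr eqxx mulr1.
by move=> k kn; rewrite subr_eq0 eq_sym (negbTE kn) mulr0.
Qed.

Lemma mul_ell1Dl : left_distributive mul_ell1 +%R.
Proof.
move=> a b c; apply: ell1_eqP => n x.
rewrite -[RHS]/(mul_fun a c n x + mul_fun b c n x) /mul_fun.
rewrite -csumD; [|exact: mul_summable..].
by congr csum; apply/funext => k; rewrite -mulrDl.
Qed.

Lemma mul_ell1Dr : right_distributive mul_ell1 +%R.
Proof.
move=> a b c; apply: ell1_eqP => n x.
rewrite -[RHS]/(mul_fun a b n x + mul_fun a c n x) /mul_fun.
rewrite -csumD; [|exact: mul_summable..].
by congr csum; apply/funext => k; rewrite -mulrDr.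
Qed.

Lemma one_ell1_neq0 : one_ell1 != 0.
Proof.
have [x _] := dspace_nonempty S.
apply/eqP => /(congr1 (fun a : ell1 => a 0 x)) /= /eqP.
by rewrite oner_eq0.
Qed.

HB.instance Definition _ := GRing.Zmodule_isNzRing.Build ell1
  mul_ell1A mul_ell11 mul_ell1r mul_ell1Dl mul_ell1Dr one_ell1_neq0.

Lemma scale_ell1Al (c : R[i]) (a b : ell1) : c *: (a * b) = (c *: a) * b.
Proof.
apply: ell1_eqP => n x; rewrite -[LHS]/(c * mul_fun a b n x).
rewrite /mul_fun -csumZ; last exact: mul_summable.
by congr csum; apply/funext => k; rewrite mulrA.
Qed.

HB.instance Definition _ :=
  GRing.Lmodule_isLalgebra.Build R[i] ell1 scale_ell1Al.

Lemma scale_ell1Ar (c : R[i]) (a b : ell1) : c *: (a * b) = a * (c *: b).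
Proof.
apply: ell1_eqP => n x; rewrite -[LHS]/(c * mul_fun a b n x).
rewrite /mul_fun -csumZ; last exact: mul_summable.
by congr csum; apply/funext => k; rewrite mulrCA.
Qed.

HB.instance Definition _ :=
  GRing.Lalgebra_isAlgebra.Build R[i] ell1 scale_ell1Ar.

Definition star_fun (a : int -> S -> R[i]) (n : int) (x : S) : R[i] :=
  (a (- n) (iterZ (- n) x))^*.

Lemma star_subproof (a : ell1) : star_fun a \in in_ell1.
Proof.
have [A As aA] := ell1_bound a; apply/in_ell1P; split=> [n x|].
  have ac : {for x, continuous ((a (- n) : S -> R[i]^o) \o iterZ (- n))}.
    apply: (@continuous_comp _ _ R[i]^o (iterZ (- n)) (a (- n))).
      exact: iterZ_continuous.
    exact: ell1_continuous.
  apply/cvgrPdist_lt => e e0; move/cvgrPdist_lt : ac => /(_ e e0).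
  apply: filterS => y /=; rewrite /star_fun -rmorphB.
  by rewrite -(normcJ (a _ _ - a _ _)).
exists (A \o -%R); first by apply: pos_summable_reindex => //; exists -%R; exact: opprK.
move=> n x; rewrite /star_fun /=.
by rewrite -lecR -normc_norm normcJ normc_norm lecR aA.
Qed.

Definition star (a : ell1) : ell1 := Ell1 (star_subproof a).

End Ell1.

Section Representations.
Variables (K : fieldType) (A : algType K).

(* Representations need not be unital. *)
Record representation (E : lmodType K) := Representation {
  rep_op :> A -> E -> E;
  rep_linear : forall a, linear (rep_op a);
  rep_linear_arg : forall v, linear (rep_op^~ v);
  repM : forall a b v, rep_op (a * b) v = rep_op a (rep_op b v)
}.

Definition invariant_subspace (E : lmodType K) (rho : representation E)
    (U : {pred E}) :=
  GRing.submod_closed U /\ forall a v, v \in U -> rho a v \in U.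

Definition alg_irreducible (E : lmodType K) (rho : representation E) :=
  (exists a v, rho a v != 0) /\
  forall U : {pred E}, invariant_subspace rho U -> U =i pred1 0 \/ U =i predT.

Definition alg_equivalent (E F : lmodType K) (rho : representation E)
    (rho' : representation F) :=
  exists f : {linear E -> F},
    bijective f /\ forall a v, f (rho a v) = rho' a (f v).

Definition rep_ker (E : lmodType K) (rho : representation E) : set A :=
  [set a | forall v, rho a v = 0].

(* A [vectType] is finite dimensional. *)
Record fdrep := FDRep {
  fdspace : vectType K;
  fdrep_rep :> representation fdspace
}.

(* Classes of representations are plain predicates: [set fdrep] would be a
   universe inconsistency. *)
Definition rep_class := fdrep -> Prop.

Definition alg_class (rho : fdrep) : rep_class :=
  fun rho' => alg_equivalent rho rho'.

Definition fd_irr_class (c : rep_class) :=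
  exists2 rho : fdrep, alg_irreducible rho & c = alg_class rho.

End Representations.

Section StarStructure.
Variables (R : realType) (S : dynSystem).

Definition selfadjoint (I : set (ell1 R S)) := [set star a | a in I] = I.

(* [{dot E for Num.conj}] is the type of inner products on E, linear in the
   first variable. When E is finite dimensional, completeness is automatic, so
   this is a Hilbert space structure. *)
Definition star_representation (E : lmodType R[i])
    (form : {dot E for Num.conj}) (rho : representation (ell1 R S) E) :=
  forall a u v, form (rho a u) v = form u (rho (star a) v).

End StarStructure.

Definition circle (R : realType) := {l : R[i] | `|l| == 1}.

Lemma map_conj_trK (C : numClosedFieldType) (n : nat) (N : 'M[C]_n) :
  map_mx Num.conj (map_mx Num.conj N^T)^T = N.
Proof. by apply/matrixP => i j; rewrite !mxE conjCK. Qed.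

Section PeriodicRep.
Variables (R : realType) (S : dynSystem) (x : S) (l : circle R).
Local Notation p := (period x).
Local Notation A := (ell1 R S).
Implicit Types (a b : A) (i j r : 'I_p) (m n k : int).

(* delta^n maps e_j to l^q e_i, where j + n = q p + i and 0 <= i < p, and f maps
   e_i to f(sigma^i x) e_i. Hence sum_n f_n delta^n maps e_j to the sum over n of
   l^q f_n(sigma^i x) e_i; this is row j of [pi_mx]. The e_j are the standard
   basis 'e_j of 'rV_p. Lemmas [pi_rep1], [pi_rep_fun], [pi_rep_delta],
   [pi_rep_delta_last] and [pi_rep_star] check the defining properties, the last
   one for the standard inner product [dotmx]. *)
Definition pi_weight m i : R[i] :=
  if (m %% p)%Z == i%:Z then val l ^ (m %/ p)%Z else 0.

Definition pi_mx a : 'M[R[i]]_p :=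
  \matrix_(j, i) csum (fun n : int => pi_weight (j%:Z + n) i * a n (iterZ i x)).

Definition pi_op a (v : 'rV[R[i]]_p) : 'rV[R[i]]_p := v *m pi_mx a.

Lemma ord_period (i : 'I_p) : (0 < p)%N /\ iterZ p x = x.
Proof.
have p0 : (0 < p)%N by case: i => i; exact: leq_ltn_trans.
apply: iterZ_period; apply: contrapT => nf.
by move: p0; rewrite /period /fset_set; case: pselect.
Qed.

Lemma circle_neq0 : val l != 0.
Proof. by rewrite -normr_gt0 (eqP (valP l)). Qed.

Lemma circle_conj : (val l)^* = (val l)^-1.
Proof.
apply: (mulfI circle_neq0); rewrite divff ?circle_neq0//.
by rewrite -sqr_normc (eqP (valP l)) expr1n.
Qed.

Lemma circle_normXz (n : int) : `|val l ^ n| = 1.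
Proof.
have l1 := eqP (valP l); case: n => n; first by rewrite -exprnP normrX l1 expr1n.
by rewrite NegzE -invr_expz normfV -exprnP normrX l1 expr1n invr1.
Qed.

Lemma pi_weight_norm m i : normc (pi_weight m i) <= 1.
Proof.
rewrite -lecR -normc_norm /pi_weight; case: ifP => _; last by rewrite normr0 lecR.
by rewrite circle_normXz.
Qed.

Lemma pi_summable a m i :
  abs_summable (fun n : int => pi_weight (m + n) i * a n (iterZ i x)).
Proof.
have [M Ms aM] := ell1_bound a; apply: abs_summable_le Ms => n.
rewrite normcM -[M n]mul1r ler_pM ?normc_ge0//; exact: pi_weight_norm.
Qed.

Lemma pi_mx_linear (c : R[i]) a b :
  pi_mx (c *: a + b) = c *: pi_mx a + pi_mx b.
Proof.
apply/matrixP => j i; rewrite !mxE -csumZ; last exact: pi_summable.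
rewrite -csumD; last exact: pi_summable; last first.
  by apply: abs_summableZ; exact: pi_summable.
congr csum; apply/funext => n.
rewrite -[(c *: a + b) n _]/(c * a n (iterZ i x) + b n (iterZ i x)).
by rewrite mulrDr mulrCA.
Qed.

Lemma pi_op_linear a : linear (pi_op a).
Proof. by move=> c u v; rewrite /pi_op mulmxDl scalemxAl. Qed.

Lemma pi_op_linear_arg v : linear (pi_op^~ v).
Proof. by move=> c a b; rewrite /pi_op pi_mx_linear mulmxDr scalemxAr. Qed.

Lemma pi_weight_ord m i : (m %% p)%Z == i%:Z -> m = (m %/ p)%Z * p%:Z + i%:Z.
Proof. by move=> /eqP mi; rewrite {1}(divz_eq m p) mi. Qed.

Lemma pi_weightE (q : int) i : pi_weight (q * p%:Z + i%:Z) i = val l ^ q.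
Proof.
have [p0 _] := ord_period i.
have pn0 : p%:Z != 0 by rewrite -lt0n.
rewrite /pi_weight modzMDl divzMDl// modz_small ?ltz_nat ?ltn_ord//.
by rewrite eqxx divz_small ?ltz_nat ?ltn_ord// addr0.
Qed.

Lemma pi_weightMD (q m : int) i :
  pi_weight (q * p%:Z + m) i = val l ^ q * pi_weight m i.
Proof.
have [p0 _] := ord_period i.
have pn0 : p%:Z != 0 by rewrite -lt0n.
rewrite /pi_weight modzMDl divzMDl//; case: ifP => _; last by rewrite mulr0.
by rewrite expfzDr ?circle_neq0.
Qed.

Lemma iterZ_weight m i : (m %% p)%Z == i%:Z -> iterZ i x = iterZ m x.
Proof.
have [_ px] := ord_period i => /eqP mi.
by rewrite (iterZ_mod m px) mi.
Qed.

Lemma pi_mxM a b : pi_mx (a * b) = pi_mx b *m pi_mx a.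
Proof.
apply/matrixP => j i; rewrite !mxE.
have [p0 px] := ord_period i; have pn0 : p%:Z != 0 by rewrite -lt0n.
set y := iterZ i x.
pose H (k m : int) := pi_weight (j%:Z + m + k) i * (a k y * b m (iterZ (- k) y)).
have Hs : abs_summable (fun q => H q.1 q.2).
  have [MA As aA] := ell1_bound a; have [MB Bs bB] := ell1_bound b.
  apply: abs_summable_le (pos_summable_mul As Bs) => -[k m] /=.
  rewrite /H normcM -[leRHS]mul1r ler_pM ?normc_ge0//.
    exact: pi_weight_norm.
  by rewrite normcM ler_pM ?normc_ge0.
transitivity (csum (fun q => H q.1 q.2)).
  rewrite -(csum_reindex _ conv_bij).
  pose G (n k : int) := H k (n - k).
  rewrite -[RHS]/(csum (fun q => G q.1 q.2)) csum_pair; last first.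
    exact: (abs_summable_reindex conv_bij Hs).
  congr csum; apply/funext => n.
  rewrite -[(a * b) n _]/(mul_fun a b n y) -csumZ; last exact: mul_summable.
  by congr csum; apply/funext => k; rewrite /G /H -[_ + k]addrA subrK.
pose W r (q : int * int) :=
  (pi_weight (r%:Z + q.1) i * a q.1 y) *
  (pi_weight (j%:Z + q.2) r * b q.2 (iterZ r x)).
have Ws r : abs_summable (W r).
  exact: (abs_summable_mul (pi_summable a r i) (pi_summable b j r)).
have WE r : pi_mx b j r * pi_mx a r i = csum (W r).
  by rewrite !mxE mulrC csum_mul//; exact: pi_summable.
under eq_bigr do rewrite WE.
have [_ <-] := csum_sum Ws.
congr csum; apply/funext => -[k m]; rewrite /W /H /=.
have r0 : (0 <= (j%:Z + m) %% p)%Z by rewrite modz_ge0.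
have rl : ((j%:Z + m) %% p < p)%Z by rewrite ltz_pmod.
have [r rE] : exists r, ((j%:Z + m) %% p)%Z = r%:Z.
  by case: (_ %% _)%Z r0 rl => // r _ rl; exists (Ordinal (rl : (r < p)%N)).
rewrite (bigD1 r)//= big1 ?addr0; last first.
  move=> s /negbTE sr; rewrite [pi_weight _ s]/pi_weight rE.
  by rewrite eqz_nat eq_sym -[_ == _]/(s == r) sr mul0r mulr0.
have jm := pi_weight_ord (introT eqP rE).
rewrite {1}jm -addrA pi_weightMD [in pi_weight _ r]jm pi_weightE.
have [ri|/negbTE ri] := boolP (((r%:Z + k) %% p)%Z == i%:Z); last first.
  by rewrite /pi_weight ri mulr0 !mul0r.
have -> : iterZ (- k) y = iterZ r x.
  by rewrite /y (iterZ_weight ri) addrC iterZD iterZK.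
by rewrite [_ ^ _ * pi_weight _ _]mulrC mulrACA.
Qed.

Lemma pi_opM a b v : pi_op (a * b) v = pi_op a (pi_op b v).
Proof. by rewrite /pi_op pi_mxM mulmxA. Qed.

Definition pi_rep : representation A 'rV[R[i]]_p :=
  Representation pi_op_linear pi_op_linear_arg pi_opM.

Lemma pi_rep1 v : pi_rep 1 v = v.
Proof.
suff : pi_mx 1 = 1%:M by move=> /= p1; rewrite /pi_op p1 mulmx1.
apply/matrixP => j i; have [p0 px] := ord_period i; rewrite !mxE.
rewrite (@csum1 _ _ _ (0 : int)); last first.
  move=> n /negbTE n0.
  by rewrite -[(1 : A) n _]/(if n == 0 then 1 else 0) n0 mulr0.
rewrite -[(1 : A) 0 _]/(1 : R[i]) mulr1 addr0 /pi_weight.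
rewrite modz_small ?divz_small ?ltz_nat ?ltn_ord// eqz_nat.
by rewrite -[_ == _ :> nat]/(j == i); case: (j == i).
Qed.

Lemma pi_rep_fun (g : S -> R[i]) (gc : continuous (g : S -> R[i]^o)) j :
  pi_rep (monom gc 0) 'e_j = g (iterZ j x) *: 'e_j.
Proof.
rewrite /= /pi_op -rowE; apply/rowP => i; rewrite !mxE.
rewrite (@csum1 _ _ _ (0 : int)); last by move=> n /negbTE /= ->; rewrite mulr0.
rewrite /= addr0 /pi_weight modz_small ?divz_small ?ltz_nat ?ltn_ord//.
rewrite eqz_nat -[_ == _ :> nat]/(j == i) [i == j]eq_sym.
by case: eqVneq => [->|_]; rewrite ?mul1r ?mulr1 ?mul0r ?mulr0.
Qed.

Definition delta : A := monom (@cst_continuous S R[i]^o 1) 1.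

Lemma pi_mx_delta j i : pi_mx delta j i = pi_weight (j%:Z + 1) i.
Proof.
rewrite !mxE (@csum1 _ _ _ (1 : int)); first by rewrite /= mulr1.
by move=> n /negbTE /= ->; rewrite mulr0.
Qed.

Lemma pi_rep_delta j i : j.+1 = i -> pi_rep delta 'e_j = 'e_i.
Proof.
move=> ji; rewrite /= /pi_op -rowE; apply/rowP => s; rewrite mxE pi_mx_delta mxE.
rewrite -PoszD addn1 ji /pi_weight.
rewrite modz_small ?divz_small ?ltz_nat ?ltn_ord// eqz_nat.
by rewrite -[_ == _ :> nat]/(i == s) [s == i]eq_sym eqxx; case: (i == s).
Qed.

Lemma pi_rep_delta_last j i : j.+1 = p -> i = 0%N :> nat ->
  pi_rep delta 'e_j = val l *: 'e_i.
Proof.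
move=> jp i0; rewrite /= /pi_op -rowE; apply/rowP => s.
rewrite mxE pi_mx_delta !mxE -PoszD addn1 jp.
have [p0 _] := ord_period i; have pn0 : p%:Z != 0 by rewrite -lt0n.
rewrite /pi_weight modzz divzz pn0 eqz_nat -i0 -[_ == _ :> nat]/(i == s).
by rewrite [s == i]eq_sym eqxx; case: (i == s); rewrite ?mulr1 ?mulr0.
Qed.

Lemma pi_mx_star a : pi_mx (star a) = map_mx Num.conj (pi_mx a)^T.
Proof.
apply/matrixP => j i; rewrite !mxE.
have bN : bijective (-%R : int -> int) by exists -%R; exact: opprK.
rewrite -[LHS](csum_reindex _ bN) -[RHS]/((csum _)^*) -csum_conj.
congr csum; apply/funext => n /=; rewrite rmorphM /star_fun /= opprK.
have [ji|/negbTE ji] := boolP (((i%:Z + n) %% p)%Z == j%:Z).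
  rewrite -[iter i _ x]/(iterZ i x) -[iter j _ x]/(iterZ j x).
  rewrite (iterZ_weight ji) [i%:Z + n]addrC iterZD; congr (_ * _).
  have E := pi_weight_ord ji; rewrite [n + _]addrC {1}E pi_weightE.
  have -> : j%:Z - n = - ((i%:Z + n) %/ p)%Z * p%:Z + i%:Z.
    by rewrite mulNr; move: E; set t := (_ * _); lia.
  by rewrite pi_weightE fmorphXz /= circle_conj exprz_inv.
rewrite [in RHS]/pi_weight ji rmorph0 mul0r.
rewrite /pi_weight; case: ifP => ij; last by rewrite mul0r.
have E := pi_weight_ord ij.
suff : ((i%:Z + n) %% p)%Z == j%:Z by rewrite ji.
have -> : i%:Z + n = - ((j%:Z - n) %/ p)%Z * p%:Z + j%:Z.
  by rewrite mulNr; move: E; set t := (_ * _); lia.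
by rewrite modzMDl modz_small ?ltz_nat ?ltn_ord.
Qed.

Lemma pi_rep_star : star_representation (@dotmx R[i] p) pi_rep.
Proof.
move=> a u v.
rewrite -[LHS]/(dotmx (pi_op a u) v) -[RHS]/(dotmx u (pi_op (star a) v)).
by rewrite !dotmxE /pi_op pi_mx_star trmx_mul map_mxM map_conj_trK /= mulmxA.
Qed.

Definition pi_fdrep : fdrep A := FDRep pi_rep.

End PeriodicRep.

(* Main.v *)
(* Let w be a nonzero vector of a finite dimensional irreducible representation
   on which every g in C(X) acts as the scalar g(x); compactness of X provides
   such an x for every common eigenvector of C(X). The vectors delta^n w have
   the points sigma^n x as characters, so x is periodic by finite
   dimensionality, and w can be taken to be an eigenvector of delta^p, with p
   the period of x; the eigenvalue has modulus 1.
   No continuity of the representation is assumed. It is replaced by the Neumann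
   series: an element of small norm cannot fix a nonzero vector. If an element
   d kills e_0 in pi_{x,lambda} but not w, then some c = b d kills e_0 and fixes
   w; cutting off the tail of c yields an element of small norm that fixes w.
   Hence e_0 |-> w extends to an intertwiner, which is bijective by Schur's
   lemma. *)
Require Import Defs.
From HB Require Import structures.
From mathcomp Require Import all_boot all_order all_algebra.
From mathcomp Require Import sesquilinear spectral finmap.
From mathcomp Require Import all_classical all_reals all_analysis.
From mathcomp Require Import complex.
From mathcomp Require Import zify ring lra.
Set Implicit Arguments. Unset Strict Implicit. Unset Printing Implicit Defensive.
Import Order.TTheory GRing.Theory Num.Theory.
Import numFieldNormedType.Exports.
Import Normc.
Local Open Scope classical_set_scope.
Local Open Scope ring_scope.
Local Open Scope complex_scope.
Local Notation normc := (@Normc.normc _).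

(** * Stable subspaces and common eigenvectors in finite dimension *)

Section LinearAlgebra.
Import VectorInternalTheory.

(** A [{vspace E}] inside [P] of maximal dimension contains every vector of [P], since adjoining one
    cannot raise the dimension. *)
Lemma submod_vspace (C : fieldType) (E : vectType C) (P : {pred E}) :
  GRing.submod_closed P -> exists U : {vspace E}, U =i P.
Proof.
move=> [P0 Pl].
pose Q n := `[< exists2 U : {vspace E}, {subset U <= P} & \dim U = n >].
have exQ : exists n, Q n.
  by exists 0%N; apply/asboolP; exists 0%VS; rewrite ?dimv0// => u /vlineP[k ->]; rewrite scaler0.
have ubQ n : Q n -> (n <= \dim {:E})%N.
  by move=> /asboolP[U _ <-]; rewrite dimvS// subvf.
case: (ex_maxnP exQ ubQ) => n /asboolP[U UP dU] maxn.
exists U => u; apply/idP/idP; first exact: UP.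
move=> uP; have : Q (\dim (U + <[u]>)).
  apply/asboolP; exists (U + <[u]>)%VS => // _ /memv_addP[a aU [_ /vlineP[k ->] ->]].
  by rewrite addrC; apply: Pl => //; exact: UP.
move=> /maxn; rewrite -dU => dUu.
have /eqP -> : U == (U + <[u]>)%VS by rewrite eqEdim addvSl.
by apply: subvP (memv_line u); exact: addvSr.
Qed.

Lemma stable_eigenvector (C : numClosedFieldType) (E : vectType C)
    (T : {linear E -> E}) (U : {vspace E}) :
  U != 0%VS -> (forall u, u \in U -> T u \in U) ->
  exists c, exists2 u, u \in U & u != 0 /\ T u = c *: u.
Proof.
move=> U0 UT.
(* The matrix of [T] restricted to [U]; [vsproj U] changes nothing because [T] maps [U] to
   itself. *)
pose M := lin1_mx (v2r \o vsproj U \o T \o vsval \o @r2v _ (subvs_of U)).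
have [|a /eigenvalueP[w wM w0]] := eigenvalue_closed M.
  by rewrite /dim /= lt0n dimv_eq0.
exists a, (vsval (r2v w)); first exact: subvsP.
split.
  apply: contra w0 => /eqP u0; rewrite -(r2vK w).
  by rewrite (_ : r2v w = 0) ?linear0//; apply/val_inj.
have : r2v (w *m M) = r2v (a *: w) by rewrite wM.
rewrite mul_rV_lin1 /= v2rK linearZ /= => /(congr1 vsval).
by rewrite vsprojK ?UT ?subvsP.
Qed.

(** The family can be infinite, so there is no induction over it. In a nonzero stable subspace of
    minimal dimension, any nonzero eigenspace of any [T i] is stable by commutation, hence is the
    whole subspace. *)
Lemma common_eigenvector_family (C : numClosedFieldType) (E : vectType C) (I : Type)
    (T : I -> {linear E -> E}) (P : {pred E}) (v : E) :
  GRing.submod_closed P -> (forall i u, u \in P -> T i u \in P) ->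
  (forall i j u, u \in P -> T i (T j u) = T j (T i u)) ->
  v \in P -> v != 0 ->
  exists2 u, u \in P & u != 0 /\ forall i, exists c, T i u = c *: u.
Proof.
move=> Pm PT comm vP v0.
pose Q n := `[< exists U : {vspace E}, [/\ {subset U <= P},
  forall i u, u \in U -> T i u \in U, U != 0%VS & \dim U = n] >].
have exQ : exists n, Q n.
  have [U UP] := submod_vspace Pm.
  exists (\dim U); apply/asboolP; exists U; split=> //.
  - by move=> u; rewrite UP.
  - by move=> i u; rewrite !UP; exact: PT.
  - by apply: contra v0 => /eqP U0; rewrite -UP U0 memv0 in vP.
case: (ex_minnP exQ) => n /asboolP[U [UP UT U0 dU]] minn.
exists (vpick U); first exact/UP/memv_pick.
split; first by rewrite vpick0.
move=> i; have [c [u uU [u0 Tu]]] := stable_eigenvector U0 (UT i).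
exists c.
pose W : {pred E} := [pred x | (x \in U) && (T i x == c *: x)].
have Wm : GRing.submod_closed W.
  split; first by rewrite !inE mem0v linear0 scaler0 eqxx.
  move=> a x y; rewrite !inE => /andP[xU /eqP Tx] /andP[yU /eqP Ty].
  by rewrite memvD ?memvZ//= linearP Tx Ty scalerDr !scalerA mulrC.
have [V VW] := submod_vspace Wm.
have VU : (V <= U)%VS by apply/subvP => x; rewrite VW inE => /andP[].
have : Q (\dim V).
  apply/asboolP; exists V; split=> //.
  - by move=> x /(subvP VU)/UP.
  - move=> j x; rewrite !VW !inE => /andP[xU /eqP Tx]; rewrite UT//=.
    by rewrite comm ?Tx ?linearZ//; exact: UP.
  - apply: contra u0 => /eqP V0; have : u \in V by rewrite VW inE uU Tu eqxx.
    by rewrite V0 memv0.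
move=> /minn; rewrite -dU => dUV.
have /eqP VE : V == U by rewrite eqEdim VU.
have : vpick U \in V by rewrite VE memv_pick.
by rewrite VW inE => /andP[_ /eqP].
Qed.

End LinearAlgebra.

(** * Shifted, geometric and one-term sums *)

Section NatSums.
Variable R : realType.

Lemma pos_summable_shift (f : nat -> R) : pos_summable f ->
  pos_summable (fun n => f n.+1) /\ psum f = f 0%N + psum (fun n => f n.+1).
Proof.
move=> [f0 fs].
have fE : (\esum_(i in [set: nat]) (f i)%:E =
    (f 0%N)%:E + \esum_(i in [set: nat]) (f i.+1)%:E)%E.
  rewrite (esumID [set 0%N]); last by move=> n _; rewrite lee_fin.
  rewrite !setTI esum_set1 ?lee_fin//; congr (_ + _)%E.
  rewrite (@reindex_esum _ _ _ [set: nat] (~` [set 0%N]) succn)//.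
  split=> [//|_ _ _ _ []//|[|n] //= _]; by exists n.
have fs' : pos_summable (fun n => f n.+1).
  split=> //; apply: le_lt_trans fs; rewrite fE.
  by rewrite leeDr// lee_fin.
split=> //; apply: EFin_inj; rewrite EFinD -!psumK//.
Qed.

Lemma csum_nat_recl (u : nat -> R[i]) : abs_summable u ->
  csum u = u 0%N + csum (fun n => u n.+1).
Proof.
have rs (f : nat -> R) : pos_summable (fun i => `|f i|) ->
    rsum f = f 0%N + rsum (fun n => f n.+1).
  move=> /rsum_posneg[ps ns fE]; rewrite (rsum_diff ps ns fE).
  have [ps' ->] := pos_summable_shift ps.
  have [ns' ->] := pos_summable_shift ns.
  rewrite (rsum_diff ps' ns' (fun n => fE n.+1)) [in RHS]fE /=.
  by rewrite opprD addrACA.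
move=> us; rewrite /csum (rs _ (abs_summable_Re us)) (rs _ (abs_summable_Im us)) /=.
by case: (u 0%N).
Qed.

Lemma pos_summable_geometric (b : nat -> R) :
  (forall k, 0 <= b k <= 2^-1 ^+ k) -> pos_summable b.
Proof.
move=> bb; split; first by move=> k; case/andP: (bb k).
(* [2 / 2 ^ (k + 1)] is [2^-1 ^+ k] in the form that [cvg_geometric_eseries_half] sums. *)
apply: (@le_lt_trans _ _ (\esum_(k in [set: nat]) (2 / (2 ^ (k + 1))%:R)%:E)%E).
  apply: le_esum => k _; rewrite lee_fin; have /andP[_ bk] := bb k.
  by rewrite addn1 expnS natrM invfM mulrA divff ?pnatr_eq0// mul1r natrX -exprVn.
rewrite -nneseries_esumT; last by move=> k; rewrite lee_fin divr_ge0.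
by rewrite (cvg_lim _ (@cvg_geometric_eseries_half R 2 0))// ltry.
Qed.

Lemma psum1 (T : choiceType) (f : T -> R) t : 0 <= f t ->
  (forall i, i != t -> f i = 0) -> pos_summable f /\ psum f = f t.
Proof.
move=> ft0 ft.
have f0 i : 0 <= f i by have [->//|/ft ->] := eqVneq i t.
have u1 i : i != t -> (f i)%:C%C = 0 by move=> /ft ->.
have nu i : normc (f i)%:C = f i.
  by apply: complexI; rewrite -normc_norm ger0_norm ?ler0c.
have fs : pos_summable f.
  have := abs_summable1 u1; rewrite /abs_summable.
  by rewrite (_ : _ \o _ = f)//; apply/funext => i; exact: nu.
by split=> //; apply: complexI; rewrite -csum_pos// (csum1 u1).
Qed.

Lemma psum_reindex (T T' : choiceType) (e : T -> T') (f : T' -> R) :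
  bijective e -> psum (f \o e) = psum f.
Proof.
move=> be; have bT : set_bij [set: T] [set: T'] e by rewrite setTT_bijective.
by rewrite /psum [in RHS](@reindex_esum _ _ _ _ _ _ _ bT).
Qed.

End NatSums.

(** * Norm estimates by majorants, and the Neumann series *)

Section Neumann.
Variables (R : realType) (S : dynSystem).
Local Notation A := (ell1 R S).
Implicit Types (a b : A) (M : int -> R).

(** Norm estimates go through an explicit real majorant instead of the extended real [l1norm];
    [ell1_le a e] then amounts to [l1norm a <= e]. *)
Definition majorized a M := pos_summable M /\ forall n x, normc (a n x) <= M n.

Definition ell1_le a (e : R) := exists2 M, majorized a M & psum M <= e.

(** Twice the convolution: the factor comes from [normc_csum_le], which bounds real and imaginary
    parts separately. *)
Definition conv M N := fun n => 2 * psum (fun k => M k * N (n - k)).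

(** By Fubini, the substitution [(n, k) |-> (k, n - k)] turns the double sum into a product. *)
Lemma psum_conv M N : pos_summable M -> pos_summable N ->
  pos_summable (conv M N) /\ psum (conv M N) = 2 * (psum M * psum N).
Proof.
move=> Ms Ns; have [ss sp] := conv_summable Ms Ns.
split; first exact: pos_summableZ.
have MN := pos_summable_mul Ms Ns.
rewrite /conv psumZ//; congr (2 * _).
rewrite -(@psum_pair _ _ _ (fun n k => M k * N (n - k))); last first.
  exact: (pos_summable_reindex conv_bij MN).
rewrite -[LHS]/(psum ((fun k : int * int => M k.1 * N k.2) \o
  (fun k : int * int => (k.2, k.1 - k.2)))) (psum_reindex _ conv_bij).
rewrite (@psum_pair _ _ _ (fun i j => M i * N j))//.
have [M0 _] := Ms.
under eq_fun do rewrite psumZ// mulrC.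
by rewrite psumZ ?psum_ge0// 1?mulrC//; case: Ns.
Qed.

Lemma majorizedM a b M N : majorized a M -> majorized b N ->
  majorized (a * b) (conv M N).
Proof.
move=> [Ms aM] [Ns bN]; split; first by case: (psum_conv Ms Ns).
have [ss _] := conv_summable Ms Ns.
move=> n x; apply: le_trans (normc_csum_le (mul_summable a b n x)) _.
rewrite /conv mulr_natl lerMn2r/=; apply: le_psum => // k /=.
by rewrite normc_ge0 normcM ler_pM ?normc_ge0.
Qed.

Lemma majorized1 : majorized (1 : A) (fun n => (n == 0)%:R) /\
  psum (fun n : int => (n == 0)%:R : R) = 1.
Proof.
pose f (n : int) : R := (n == 0)%:R.
have f0 n : n != 0 -> f n = 0 by rewrite /f => /negbTE ->.
have [sM pM] := psum1 (ler0n R _ : 0 <= f 0) f0.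
split; last by rewrite -[LHS]/(psum f) pM.
split; first exact: sM.
move=> n x; rewrite -[(1 : A) n x]/(if n == 0 then 1 else 0 : R[i]).
by case: eqP => _; rewrite ?normc0// -lecR -normc_norm normr1.
Qed.

(* 1/4 instead of a bound less than 1: [normc_csum_le] costs a factor 2 at each
   multiplication. *)
Lemma neumann (r : A) : ell1_le r 4^-1 -> exists s : A, s * (1 - r) = 1.
Proof.
move=> [M [Ms rM] Mle].
have [M1 pM1] := majorized1.
(* [B k] majorizes [r ^+ k], and its sum is at most [(2 * 4^-1) ^+ k]. *)
pose B k := iter k (fun N => conv N M) (fun n => (n == 0)%:R).
have BM k : majorized (r ^+ k) (B k).
  elim: k => [|k IHk]; first by rewrite expr0.
  by rewrite exprSr; exact: majorizedM.
have B0 k n : 0 <= B k n by case: (BM k) => -[].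
have Bgeo : pos_summable (fun k => psum (B k)).
  apply: pos_summable_geometric => k; rewrite psum_ge0//=.
  elim: k => [|k IHk]; first by rewrite pM1.
  have [_ pc] := psum_conv (BM k).1 Ms.
  rewrite -[B k.+1]/(conv (B k) M) pc exprSr.
  have -> : 2 * (psum (B k) * psum M) = psum (B k) * (2 * psum M) by ring.
  apply: ler_pM => //; first exact: psum_ge0.
    by rewrite mulr_ge0// psum_ge0//; case: Ms.
  by lra.
have Bs : pos_summable (fun k : nat * int => B k.1 k.2).
  by apply/(psum_slices B0); split=> // k; exact: (BM k).1.
have Bs' : pos_summable (fun k : int * nat => B k.2 k.1).
  have bj : bijective (fun k : int * nat => (k.2, k.1)).
    by exists (fun k => (k.2, k.1)) => -[].
  exact: (pos_summable_reindex bj Bs).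
have [Bn Bnn] := (psum_slices (fun n k => B0 k n)).1 Bs'.
have rs n x : abs_summable (fun k => (r ^+ k) n x).
  apply: abs_summable_le (Bn n) => k; exact: (BM k).2.
have sP : (fun n x => csum (fun k => (r ^+ k) n x)) \in @in_ell1 R S.
  apply/in_ell1P; split.
    move=> n; apply: (continuous_csum (Bn n)) => k; first exact: (BM k).2.
    exact: ell1_continuous.
  exists (fun n => 2 * psum (fun k => B k n)); first exact: pos_summableZ.
  move=> n x; apply: le_trans (normc_csum_le (rs n x)) _.
  rewrite mulr_natl lerMn2r/=; apply: le_psum => // k /=.
  by rewrite normc_ge0 (BM k).2.
(* The series of the powers of [r], summed pointwise; what remains is [s = 1 + s * r]. *)
pose s : A := Ell1 sP.
exists s; rewrite mulrBr mulr1; apply/eqP; rewrite subr_eq; apply/eqP.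
apply: ell1_eqP => n x.
rewrite -[LHS]/(csum (fun k => (r ^+ k) n x)) csum_nat_recl//.
congr (_ + _); rewrite -[RHS]/(Defs.mul_fun s r n x) /Defs.mul_fun.
pose W (k : nat) (j : int) := (r ^+ k) j x * r (n - j) (iterZ (- j) x).
have Ws : abs_summable (fun k => W k.1 k.2).
  have m0 : 0 <= psum M by apply: psum_ge0; case: Ms.
  apply: abs_summable_le (pos_summableZ m0 Bs) => -[k j] /=.
  rewrite /W normcM mulrC ler_pM ?normc_ge0//; last exact: (BM k).2.
  apply: le_trans (rM _ _) _.
  by have := psum_le_sup (finite_set1 (n - j)) Ms; rewrite fsbig_set1.
(* Term [k] of the shifted series is [r ^+ k * r]; exchanging the sums over [k] and [j] gives
   [s * r]. *)
transitivity (csum (fun k => csum (W k))).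
  by congr csum; apply/funext => k; rewrite exprSr.
rewrite -csum_pair//.
have bj : bijective (fun k : int * nat => (k.2, k.1)).
  by exists (fun k => (k.2, k.1)) => -[].
rewrite -(csum_reindex _ bj).
rewrite -[LHS]/(csum (fun k => (fun j k => W k j) k.1 k.2)) csum_pair; last first.
  exact: (abs_summable_reindex bj Ws).
by congr csum; apply/funext => j; rewrite -csumZr.
Qed.

End Neumann.

(** * Irreducible representations, Schur's lemma and equivalence *)

Section RepresentationTheory.
Variables (K : fieldType) (A : algType K).
Implicit Types (E F G : lmodType K).

HB.instance Definition _ E (rho : representation A E) (a : A) :=
  GRing.isLinear.Build K E E *:%R (rho a) (rep_linear rho a).

Section OneRep.
Variables (E : lmodType K) (rho : representation A E).
Implicit Types (a b : A) (v w : E).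

(** A named function, so that it can carry a linear structure in the algebra argument. *)
Definition rep_at v : A -> E := rho^~ v.
HB.instance Definition _ v :=
  GRing.isLinear.Build K A E *:%R (rep_at v) (rep_linear_arg rho v).

Lemma repD a b v : rho (a + b) v = rho a v + rho b v.
Proof. exact: (linearD (rep_at v)). Qed.

Lemma repB a b v : rho (a - b) v = rho a v - rho b v.
Proof. exact: (linearB (rep_at v)). Qed.

Lemma rep0 v : rho 0 v = 0.
Proof. exact: (linear0 (rep_at v)). Qed.

Lemma repZ c a v : rho (c *: a) v = c *: rho a v.
Proof. exact: (linearZ_LR (rep_at v)). Qed.

Lemma rep_sum (I : Type) (s : seq I) (a : I -> A) v :
  rho (\sum_(i <- s) a i) v = \sum_(i <- s) rho (a i) v.
Proof. exact: (linear_sum (rep_at v)). Qed.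

Lemma repZr c a v : rho a (c *: v) = c *: rho a v.
Proof. exact: (linearZ_LR (rho a)). Qed.

Lemma rep_sumr (I : Type) (s : seq I) (P : pred I) a (v : I -> E) :
  rho a (\sum_(i <- s | P i) v i) = \sum_(i <- s | P i) rho a (v i).
Proof. exact: (linear_sum (rho a)). Qed.

(** The vectors killed by the whole algebra form an invariant subspace, which is zero because the
    action is not; it contains [rho 1 v - v]. *)
Lemma irreducible_unital : alg_irreducible rho -> forall v, rho 1 v = v.
Proof.
move=> [[a0 [v0 av0]] irr] v.
pose U : {pred E} := fun u => `[< forall a, rho a u = 0 >].
have Um : invariant_subspace rho U.
  split; first split.
  - by apply/asboolP => a; rewrite linear0.
  - move=> c u1 u2 /asboolP u10 /asboolP u20; apply/asboolP => a.
    by rewrite linearP /= u10 u20 scaler0 addr0.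
  - by move=> a u /asboolP u0; apply/asboolP => b; rewrite -repM u0.
have [U0|UT] := irr U Um; last first.
  by have /asboolP/(_ a0)/eqP := UT v0; rewrite (negbTE av0).
apply/eqP; rewrite -subr_eq0 -[_ == 0]/(rho 1 v - v \in pred1 0) -U0.
by apply/asboolP => a; rewrite linearB /= -repM mulr1 subrr.
Qed.

(** The vectors [rho a w] form an invariant subspace, nonzero since it contains [w = rho 1 w]. *)
Lemma irreducible_cyclic w : alg_irreducible rho -> w != 0 ->
  forall v, exists a, rho a w = v.
Proof.
move=> irr w0 v; have [_ /(_ (fun u => `[< exists a, rho a w = u >]))] := irr.
case.
- split; first split.
  + by apply/asboolP; exists 0; exact: rep0.
  + move=> c _ _ /asboolP[a <-] /asboolP[b <-]; apply/asboolP.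
    by exists (c *: a + b); rewrite repD repZ.
  + move=> a _ /asboolP[b <-]; apply/asboolP.
    by exists (a * b); rewrite repM.
- move=> /(_ w); rewrite inE (negbTE w0) => /asboolP[].
  by exists 1; rewrite irreducible_unital.
- by move=> /(_ v) /asboolP.
Qed.

Lemma irreducible_neq0 : alg_irreducible rho -> exists v : E, v != 0.
Proof. by move=> [[a [v av]] _]; exists (rho a v). Qed.

End OneRep.

(** Schur's lemma: as [f v != 0], the kernel of [f] is not everything and its range is not zero. *)
Lemma intertwiner_bijective E F (rho : representation A E)
    (rho' : representation A F) (f : {linear E -> F}) v :
  alg_irreducible rho -> alg_irreducible rho' ->
  (forall a v, f (rho a v) = rho' a (f v)) -> f v != 0 -> bijective f.
Proof.
move=> [_ irr] [_ irr'] fM fv.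
have inj : injective f.
  pose U : {pred E} := [pred u | f u == 0].
  have : invariant_subspace rho U.
    split; first split.
    - by rewrite !inE linear0.
    - by move=> c x y; rewrite !inE linearP => /eqP -> /eqP ->; rewrite scaler0 addr0.
    - by move=> a u; rewrite !inE fM => /eqP ->; rewrite linear0.
  move=> /irr[U0|UT]; last by have := UT v; rewrite inE (negbTE fv).
  move=> x y fxy; apply/eqP; rewrite -subr_eq0 -[_ == 0]/(x - y \in pred1 0) -U0.
  by rewrite inE linearB /= fxy subrr.
have surj y : exists x, f x = y.
  have [] := irr' (fun y => `[< exists x, f x = y >]).
  - split; first split.
    + by apply/asboolP; exists 0; rewrite linear0.
    + move=> c _ _ /asboolP[a <-] /asboolP[b <-]; apply/asboolP.
      by exists (c *: a + b); rewrite linearP.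
    + by move=> a _ /asboolP[b <-]; apply/asboolP; exists (rho a b); rewrite fM.
  - move=> /(_ (f v)); rewrite inE (negbTE fv) => /asboolP[]; by exists v.
  - by move=> /(_ y) /asboolP.
have [g gK] := choice surj.
by exists g => // x; apply: inj.
Qed.

Lemma alg_equivalent_refl E (rho : representation A E) : alg_equivalent rho rho.
Proof. by exists idfun; split=> //; exists idfun. Qed.

Lemma alg_equivalent_sym E F (rho : representation A E)
  (rho' : representation A F) : alg_equivalent rho rho' -> alg_equivalent rho' rho.
Proof.
move=> [f [[g fK gK] fM]].
have gl : linear g.
  by move=> c x y; apply: (can_inj fK); rewrite linearP !gK.
pose g' : {linear F -> E} := HB.pack g (GRing.isLinear.Build K F E *:%R g gl).
exists g'; split; first by exists f.
by move=> a v; apply: (can_inj fK); rewrite fM !gK.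
Qed.

Lemma alg_equivalent_trans E F G (rho1 : representation A E)
    (rho2 : representation A F) (rho3 : representation A G) :
  alg_equivalent rho1 rho2 -> alg_equivalent rho2 rho3 -> alg_equivalent rho1 rho3.
Proof.
move=> [f [fb fM]] [g [gb gM]]; exists (g \o f : {linear E -> G}); split.
  exact: bij_comp.
by move=> a v; rewrite /= fM gM.
Qed.

Lemma alg_classP (rho rho' : fdrep A) :
  alg_class rho = alg_class rho' <-> alg_equivalent rho rho'.
Proof.
split=> [/(congr1 (fun c : rep_class A => c rho')) e|e].
  have : alg_class rho rho' by rewrite e; exact: alg_equivalent_refl.
  by [].
apply/funext => sig; apply/propext; split; apply: alg_equivalent_trans => //.
exact: alg_equivalent_sym.
Qed.

End RepresentationTheory.

(** * Continuous functions on the space *)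

Section ContinuousFunctions.
Variables (R : realType) (S : dynSystem).
Implicit Types (g h : S -> R[i]) (x y : S).

Lemma continuous_real (f : S -> R) : continuous f ->
  continuous ((fun x => (f x)%:C) : S -> R[i]^o).
Proof.
move=> fc x; apply/cvgrPdist_lt => eps eps0.
have [e e0 ->] : exists2 e : R, 0 < e & eps = e%:C.
  case: eps eps0 => a b; rewrite ltcE /= => /andP[/eqP -> a0].
  by exists a.
move/cvgrPdist_lt : (fc x) => /(_ e e0); apply: filterS => y.
by rewrite -rmorphB normc_norm ltcR /= expr0n addr0 sqrtr_sqr.
Qed.

Lemma continuous_iterZ (h : S -> R[i]) m : continuous (h : S -> R[i]^o) ->
  continuous ((fun x => h (iterZ m x)) : S -> R[i]^o).
Proof.
move=> hc x; apply: (@continuous_comp _ _ R[i]^o (iterZ m) h).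
  exact: iterZ_continuous.
exact: hc.
Qed.

Lemma continuous_conj (h : S -> R[i]) : continuous (h : S -> R[i]^o) ->
  continuous ((fun x => (h x)^*) : S -> R[i]^o).
Proof.
move=> hc x; apply/cvgrPdist_lt => e e0.
move/cvgrPdist_lt : (hc x) => /(_ e e0); apply: filterS => y /=.
by rewrite -rmorphB -(normcJ (h x - h y)).
Qed.

(** Urysohn's lemma in the normal space [S], where the finite set [s] and the point [x] are
    closed. *)
Lemma separating_function (s : seq S) x : x \notin s ->
  exists g, [/\ continuous (g : S -> R[i]^o), g x = 1 & {in s, forall y, g y = 0}].
Proof.
move=> xs.
have nS : normal_space S.
  by apply: compact_normal; [exact: dspace_hausdorff|exact: dspace_compact].
have acc : accessible_space S by apply: hausdorff_accessible; exact: dspace_hausdorff.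
have cs : closed [set` s] by apply: (accessible_finite_set_closed.1 acc); exact: finite_seq.
have cx : closed [set x] by exact: accessible_closed_set1.
have sx0 : [set` s] `&` [set x] = set0.
  by rewrite -subset0 => y [/= ys yx]; rewrite yx (negbTE xs) in ys.
have [f [fc _ f0 f1]] := (@uniform_separatorP _ R _ _).1 (normal_uniform_separator nS cs cx sx0).
exists (fun y => (f y)%:C); split.
- exact: continuous_real.
- by rewrite (f1 (f x))//; exists x.
- by move=> y ys; rewrite (f0 (f y))//; exists y.
Qed.

End ContinuousFunctions.

(** * Monomials and finite approximation in the algebra *)

Section Monomials.
Variables (R : realType) (S : dynSystem).
Local Notation A := (ell1 R S).
Implicit Types (g h : S -> R[i]) (x y : S) (m n : int).

Lemma ell1_sumE (I : Type) (s : seq I) (a : I -> A) n x :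
  (\sum_(k <- s) a k : A) n x = \sum_(k <- s) a k n x.
Proof.
elim: s => [|k s IHs]; first by rewrite !big_nil.
by rewrite !big_cons -IHs.
Qed.

(** A monomial and not a ring power, so that [n] can be negative. *)
Definition delta_pow n : A := monom (@cst_continuous S R[i]^o 1) n.

(** [ghc] is an argument so that any continuity proof of the product fits; [monom_ext] then changes
    the function. *)
Lemma monomM g h (gc : continuous (g : S -> R[i]^o))
    (hc : continuous (h : S -> R[i]^o)) m n
    (ghc : continuous ((fun x => g x * h (iterZ (- m) x)) : S -> R[i]^o)) :
  monom gc m * monom hc n = monom ghc (m + n).
Proof.
apply: ell1_eqP => k x.
rewrite -[LHS]/(Defs.mul_fun (monom gc m) (monom hc n) k x) /Defs.mul_fun /=.
rewrite (@csum1 _ _ _ m); last by move=> j /negbTE ->; rewrite mul0r.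
rewrite eqxx subr_eq addrC; case: ifP => _; rewrite ?mulr0//.
Qed.

Lemma monom_ext g h (gc : continuous (g : S -> R[i]^o))
    (hc : continuous (h : S -> R[i]^o)) m n :
  g =1 h -> m = n -> monom gc m = monom hc n.
Proof. by move=> gh ->; apply: ell1_eqP => k x /=; rewrite gh. Qed.

Lemma delta_powD m n : delta_pow (m + n) = delta_pow m * delta_pow n.
Proof.
have c1 : continuous ((fun x : S => 1 * 1 : R[i]) : S -> R[i]^o).
  by move=> x; exact: cst_continuous.
by rewrite (monomM _ _ _ c1); apply: monom_ext => // x; rewrite mulr1.
Qed.

Lemma delta_pow0 : delta_pow 0 = 1. Proof. by []. Qed.

Lemma monom_delta_pow g (gc : continuous (g : S -> R[i]^o)) m :
  monom gc m = monom gc 0 * delta_pow m.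
Proof.
have c1 : continuous ((fun x : S => g x * 1 : R[i]) : S -> R[i]^o).
  by under eq_fun do rewrite mulr1.
by rewrite (monomM _ _ _ c1); apply: monom_ext => [x|]; rewrite ?mulr1 ?add0r.
Qed.

(** Covariance, in the form that moves a function to the right past a power of delta; both sides
    equal [monom gc m]. *)
Lemma delta_pow_monom g (gc : continuous (g : S -> R[i]^o)) m :
  delta_pow m * monom (continuous_iterZ (m := m) gc) 0 = monom gc 0 * delta_pow m.
Proof.
have c1 : continuous ((fun x : S => 1 * g (iterZ m (iterZ (- m) x)) : R[i]) : S -> R[i]^o).
  by under eq_fun do rewrite mul1r iterZVK.
rewrite (monomM _ _ _ c1) -monom_delta_pow.
by apply: monom_ext => [x|]; rewrite ?mul1r ?iterZVK ?addr0.
Qed.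

Lemma monom0M g h (gc : continuous (g : S -> R[i]^o)) (hc : continuous (h : S -> R[i]^o)) :
  monom gc 0 * monom hc 0 = monom (continuous_mulC gc hc) 0.
Proof.
have c1 : continuous ((fun x : S => g x * h (iterZ (- 0) x) : R[i]) : S -> R[i]^o).
  exact: continuous_mulC.
by rewrite (monomM _ _ _ c1); apply: monom_ext.
Qed.

(** [psum_tail] chooses finitely many indices outside of which the majorant has sum below [e]; [t]
    is the part of [a] on the other indices. *)
Lemma ell1_approx (a : A) (e : R) : 0 < e -> exists (s : seq int) (t : A),
  a = \sum_(k <- s) monom (@ell1_continuous _ _ a k) k + t /\ ell1_le t e.
Proof.
move=> e0; have [M Ms aM] := ell1_bound a.
have [s [us ss se]] := psum_tail e0 Ms.
pose t := a - \sum_(k <- s) monom (@ell1_continuous _ _ a k) k.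
exists s, t; split; first by rewrite addrC subrK.
exists (fun k => if k \in s then 0 else M k); last exact: ltW.
split=> // n x.
have -> : t n x = a n x - \sum_(k <- s) (if n == k then a k x else 0).
  rewrite -[LHS]/(a n x - (\sum_(k <- s) monom (@ell1_continuous _ _ a k) k : A) n x).
  by rewrite ell1_sumE.
have [ns|ns] := boolP (n \in s).
  rewrite (bigD1_seq n)//= eqxx big1 ?addr0 ?subrr ?normc0//.
  by move=> k /negbTE kn; rewrite eq_sym kn.
rewrite big1_seq ?subr0// => k /andP[_ ks]; case: eqP => // nk.
by rewrite nk ks in ns.
Qed.

Lemma ell1_leD (a b : A) e f : ell1_le a e -> ell1_le b f -> ell1_le (a + b) (e + f).
Proof.
move=> [M [Ms aM] Me] [N [Ns bN] Nf]; exists (M \+ N); last first.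
  by rewrite psumD// lerD.
split; first exact: pos_summableD.
move=> n x; rewrite -[(a + b) n x]/(a n x + b n x).
by apply: le_trans (le_normcD _ _) _; exact: lerD.
Qed.

Lemma ell1_le_delta_pow (c : R[i]) n : ell1_le (c *: delta_pow n) (normc c).
Proof.
pose f k := if k == n then normc c else 0.
have f0 k : k != n -> f k = 0 by rewrite /f => /negbTE ->.
have [|fs fE] := @psum1 R _ f n _ f0; first by rewrite /f eqxx normc_ge0.
exists f; last by rewrite fE /f eqxx.
split=> // k x; rewrite -[X in normc X]/(c * (if k == n then 1 else 0)) /f.
by case: ifP => _; rewrite ?mulr1 ?mulr0 ?normc0.
Qed.

Lemma ell1_le_weaken (a : A) e f : e <= f -> ell1_le a e -> ell1_le a f.
Proof. by move=> ef [M aM Me]; exists M => //; exact: le_trans ef. Qed.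

Lemma ell1_le_sum p (a : 'I_p -> A) e : (forall j, ell1_le (a j) e) ->
  ell1_le (\sum_(j < p) a j) (p%:R * e).
Proof.
elim: p a => [|p IHp] a ae.
  rewrite big_ord0 mul0r; exists (fun=> 0).
    split=> [|n x]; last by rewrite normc0.
    by split=> //; rewrite esum1.
  by rewrite /psum esum1.
rewrite big_ord_recl; have -> : p.+1%:R * e = e + p%:R * e.
  by rewrite -add1n natrD mulrDl mul1r.
by apply: ell1_leD => //; exact: IHp.
Qed.

End Monomials.

(** * Return times and periods *)

Section Orbits.
Variable S : dynSystem.
Implicit Types (x y : S).

Lemma orbitZ_iterZ n x : orbitZ (iterZ n x) = orbitZ x.
Proof.
apply/seteqP; split=> [_ [m _ <-]|_ [m _ <-]].
  by exists (m + n) => //; rewrite iterZD.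
by exists (m - n) => //; rewrite iterZD iterZK.
Qed.

(** Exponents reduce modulo a return time [d], so the orbit lies among the first [d] iterates. *)
Lemma iterZ_return x (d : nat) : (0 < d)%N -> iterZ d x = x ->
  Per S x /\ (period x <= d)%N.
Proof.
move=> d0 dx.
pose s := [seq iterZ (k : nat) x | k <- iota 0 d].
have os y : orbitZ x y -> y \in s.
  move=> [n _ <-]; rewrite (iterZ_mod _ dx).
  have r0 : (0 <= n %% d)%Z by rewrite modz_ge0// -lt0n.
  have rl : (n %% d < d)%Z by rewrite ltz_pmod.
  case: (_ %% _)%Z r0 rl => // r _ rl; apply/mapP; exists r => //.
  by rewrite mem_iota.
have px : Per S x by apply: sub_finite_set (finite_seq s); exact: os.
split=> //; have := uniq_leq_size (finmap.fset_uniq (fset_set (orbitZ x))).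
move=> /(_ s); rewrite size_map size_iota; apply=> y.
by rewrite in_fset_set// inE; exact: os.
Qed.

Lemma iterZ_collision x (i j : nat) : (i < j)%N -> iterZ i x = iterZ j x ->
  Per S x /\ (period x <= j - i)%N.
Proof.
move=> ij e; apply: iterZ_return; first by rewrite subn_gt0.
by rewrite -subzn ?(ltnW ij)// addrC iterZD -e iterZK.
Qed.

Lemma iterZ_ord_inj x : injective (fun i : 'I_(period x) => iterZ i x).
Proof.
move=> i j e; apply/val_inj; have ip := ltn_ord i; have jp := ltn_ord j.
case: (ltngtP i j) => // ij.
  by have [_] := iterZ_collision ij e; lia.
by have [_] := iterZ_collision ij (esym e); lia.
Qed.

End Orbits.

(** * Joint eigenvectors of the continuous functions *)

Section JointEigenvectors.
Variables (R : realType) (S : dynSystem).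
Local Notation A := (ell1 R S).
Implicit Types (x y : S).

(** [w = 0] is allowed, so that for fixed [x] these vectors form a subspace. *)
Definition joint_eigenvector (E : lmodType R[i]) (rho : representation A E) x w :=
  forall (g : S -> R[i]) (gc : continuous (g : S -> R[i]^o)),
    rho (monom gc 0) w = g x *: w.

Section LmodRep.
Variables (E : lmodType R[i]) (rho : representation A E).
Hypothesis rho1 : forall v, rho 1 v = v.
Implicit Types (a b r : A) (v w : E).

Lemma rep_monom x w g (gc : continuous (g : S -> R[i]^o)) m :
  joint_eigenvector rho x w ->
  rho (monom gc m) w = g (iterZ m x) *: rho (delta_pow R S m) w.
Proof.
by move=> wx; rewrite monom_delta_pow -delta_pow_monom repM wx linearZ.
Qed.

Lemma joint_eigenvector_delta_pow x w m : joint_eigenvector rho x w ->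
  joint_eigenvector rho (iterZ m x) (rho (delta_pow R S m) w).
Proof. by move=> wx g gc; rewrite -repM -monom_delta_pow (rep_monom _ _ wx). Qed.

Lemma rep_delta_pow_neq0 w m : w != 0 -> rho (delta_pow R S m) w != 0.
Proof.
apply: contra => /eqP w0; rewrite -[w]rho1 -delta_pow0 -(addNr m).
by rewrite delta_powD repM w0 linear0.
Qed.

(** [1 - r] kills [w] but has a left inverse by [neumann]. Only through this fact does the norm of
    the algebra constrain a representation. *)
Lemma rep_contraction r w : ell1_le r 4^-1 -> rho r w = w -> w = 0.
Proof.
move=> /neumann[s sr] rw; rewrite -[LHS]rho1 -sr repM repB rho1 rw subrr.
exact: linear0.
Qed.

Lemma rep_delta_powX w c n k : rho (delta_pow R S n) w = c *: w ->
  rho (delta_pow R S (n * k%:Z)) w = c ^+ k *: w.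
Proof.
move=> nw; elim: k => [|k IHk]; first by rewrite mulr0 delta_pow0 rho1 scale1r.
rewrite -addn1 PoszD mulrDr mulr1 delta_powD repM nw linearZ /= IHk.
by rewrite scalerA addn1 exprS.
Qed.

(** If an eigenvalue [d] of [delta_pow m] had modulus above 1, then for large [k] the element
    [d^-k delta^(m k)] would have norm at most 1/4 and fix [w]. The same bound for the inverse power
    of delta gives the other inequality. *)
Lemma delta_pow_eigenvalue w c n : w != 0 -> rho (delta_pow R S n) w = c *: w -> `|c| == 1.
Proof.
move=> w0.
have cn0 m d : rho (delta_pow R S m) w = d *: w -> d != 0.
  move=> mw; apply: contra (rep_delta_pow_neq0 m w0) => /eqP d0.
  by rewrite mw d0 scale0r.
have le1 m d : rho (delta_pow R S m) w = d *: w -> normc d <= 1.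
  move=> mw; have d0 := cn0 _ _ mw; rewrite leNgt; apply/negP => d1.
  have [k dk] : exists k, (normc d)^-1 ^+ k <= 4^-1.
    have t1 : `|(normc d)^-1| < 1.
      by rewrite ger0_norm ?invr_ge0 ?normc_ge0// invf_lt1// (lt_trans ltr01).
    have := cvg_expr t1; move/cvgrPdist_le => /(_ 4^-1).
    rewrite invr_gt0 ltr0n => /(_ isT) [k _ /(_ k (leqnn k)) /=] hk.
    exists k; apply: le_trans hk.
    by rewrite sub0r normrN ler_norm.
  have : w = 0; last by apply/eqP.
  apply: (@rep_contraction ((d ^+ k)^-1 *: delta_pow R S (m * k%:Z))).
    apply: ell1_le_weaken (ell1_le_delta_pow _ _ _); apply: le_trans dk.
    rewrite -lecR -normc_norm rmorphXn fmorphV /= -normc_norm.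
    by rewrite normfV normrX exprVn.
  by rewrite repZ (rep_delta_powX k mw) scalerA mulVf ?scale1r// expf_neq0.
move=> nw; have c0 := cn0 _ _ nw.
rewrite eq_le normc_norm lecR (le1 _ _ nw)/= lecR.
have nw' : rho (delta_pow R S (- n)) w = c^-1 *: w.
  apply: (scalerI c0); rewrite scalerA divff// scale1r -linearZ /= -nw -repM.
  by rewrite -delta_powD addNr delta_pow0 rho1.
have := le1 _ _ nw'; rewrite -!lecR -!normc_norm normfV invf_le1//.
by rewrite normr_gt0.
Qed.

(** The zero sets of the functions killing [v] generate a proper filter, which has a cluster point
    [x] by compactness. With [c] the eigenvalue of [g], the function [g - c] kills [v], and so
    vanishes at [x]. *)
Lemma joint_eigenvectorP v : v != 0 ->
  (forall (g : S -> R[i]) (gc : continuous (g : S -> R[i]^o)),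
    exists c, rho (monom gc 0) v = c *: v) ->
  exists x, joint_eigenvector rho x v.
Proof.
move=> v0 ev.
pose ann h := exists hc : continuous (h : S -> R[i]^o), rho (monom hc 0) v = 0.
pose zeros (h : S -> R[i]) := [set y | h y = 0].
(* A function without zeros is invertible in C(X), and so cannot kill [v]. *)
have zeros_neq0 h : ann h -> zeros h !=set0.
  move=> [hc hv]; apply: contrapT => z0.
  have h0 y : h y != 0 by apply/eqP => hy; apply: z0; exists y.
  have hVc : continuous ((fun y => (h y)^-1) : S -> R[i]^o).
    by move=> y; apply: (@cvgV _ S); [exact: h0|exact: hc].
  move: v0; rewrite -[v]rho1 (_ : 1 = monom hVc 0 * monom hc 0).
    by rewrite repM hv linear0 eqxx.
  by rewrite monom0M; apply: monom_ext => // y; rewrite mulVf.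
pose F : set_system S := [set B | exists2 h, ann h & zeros h `<=` B].
have Fp : ProperFilter F.
  apply: Build_ProperFilter_ex => [B [h /zeros_neq0[y hy] /(_ y hy) By]|].
    by exists y.
  split=> [|B C [h [hc hv] hB] [k [kc kv] kC]|B C BC [h hI hB]]; last first.
  - by exists h => //; exact: subset_trans BC.
  (* [|h|^2 + |k|^2] also kills [v], and vanishes exactly at the common zeros of [h] and [k]. *)
  - have hhc := continuous_mulC (continuous_conj hc) hc.
    have kkc := continuous_mulC (continuous_conj kc) kc.
    have sc : continuous ((fun y => (h y)^* * h y + (k y)^* * k y) : S -> R[i]^o).
      by move=> y; apply: (@cvgD _ R[i]^o); [exact: hhc|exact: kkc].
    exists (fun y => (h y)^* * h y + (k y)^* * k y).
      exists sc; have -> : monom sc 0 = monom (continuous_conj hc) 0 * monom hc 0 +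
          monom (continuous_conj kc) 0 * monom kc 0 :> A.
        rewrite !monom0M; apply: ell1_eqP => n y.
        rewrite -[RHS]/((if n == 0 then _ else 0) + (if n == 0 then _ else 0)) /=.
        by case: ifP => _; rewrite ?addr0.
      by rewrite repD !repM hv kv !linear0 addr0.
    move=> y /= /eqP; rewrite paddr_eq0; last 2 first.
    + by rewrite mulrC -sqr_normc exprn_ge0.
    + by rewrite mulrC -sqr_normc exprn_ge0.
    rewrite !mulf_eq0 !conjc_eq0 !orbb => /andP[/eqP hy /eqP ky].
    by split; [exact: hB|exact: kC].
  - have c0 := @cst_continuous S R[i]^o 0.
    exists (fun=> 0) => //; exists c0.
    have -> : monom c0 0 = 0 :> A by apply: ell1_eqP => n y /=; case: ifP.
    exact: rep0.
have [x [_ Fx]] := @dspace_compact S F Fp (filterT : F setT).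
exists x => g gc; have [c gv] := ev g gc; rewrite gv; congr (_ *: _).
have hc : continuous ((fun y => g y - c) : S -> R[i]^o).
  by move=> y; apply: (@cvgB _ R[i]^o); [exact: gc|exact: cvg_cst].
have hI : ann (fun y => g y - c).
  exists hc; have -> : monom hc 0 = monom gc 0 - c *: 1 :> A.
    apply: ell1_eqP => n y.
    rewrite -[RHS]/((if n == 0 then g y else 0) - c * (if n == 0 then 1 else 0)) /=.
    by case: ifP => _; rewrite ?mulr1 ?mulr0 ?subr0.
  by rewrite repB gv repZ rho1 subrr.
apply/eqP; rewrite eq_sym -subr_eq0; apply/negPn/negP => gxc.
(* If [g x] differs from [c], this neighbourhood of [x] misses the zero set of [g - c], although [x]
   is a cluster point. *)
have U : nbhs x [set y | g y - c != 0].
  apply: open_nbhs_nbhs; split=> //.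
  pose h : S -> R[i]^o := fun y => g y - c.
  rewrite (_ : [set y | _] = h @^-1` [set~ 0]); last first.
    by apply/seteqP; split=> y /= /eqP.
  apply: (continuousP _).1 => //; apply/closed_openC/accessible_closed_set1.
  by apply: hausdorff_accessible; exact: norm_hausdorff.
have [|y [/= gy /eqP]] := Fx (zeros (fun y => g y - c)) _ _ U; last by [].
by exists (fun y => g y - c).
Qed.

End LmodRep.

Section VectRep.
Variables (E : vectType R[i]) (rho : representation A E).
Hypothesis rho1 : forall v, rho 1 v = v.

(** For an aperiodic [x], the vectors [delta^i w] with [i <= dim E] belong to distinct points, hence
    are independent, and too many for [E]. *)
Lemma joint_eigenvector_Per x w : w != 0 -> joint_eigenvector rho x w -> Per S x.
Proof.
move=> w0 wx; apply: contrapT => nper.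
pose n := (dim E).+1.
pose X := [tuple rho (delta_pow R S (i : nat)) w | i < n].
suff : free X.
  rewrite /free size_tuple => /eqP dX.
  have := dimvS (subvf <<X>>%VS); by rewrite dX dimvf /n ltnn.
apply/freeP => k kX i.
(* The points of the other terms; a function [g] vanishing on them and equal to 1 at [iterZ i x]
   isolates the [i]-th term of the relation. *)
pose s := [seq iterZ (j : nat) x | j <- iota 0 n & j != val i].
have [g [gc gi gs]] : exists g, [/\ continuous (g : S -> R[i]^o),
    g (iterZ i x) = 1 & {in s, forall y, g y = 0}].
  apply: separating_function; apply/negP => /mapP[j].
  rewrite mem_filter => /andP[ji _] e; case: (ltngtP i j) ji => // ij _.
    by have [] := iterZ_collision ij e.
  by have [] := iterZ_collision ij (esym e).
have XE (j : 'I_n) : X`_j = rho (delta_pow R S (j : nat)) w.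
  by rewrite -tnth_nth tnth_mktuple.
have : rho (monom gc 0) (\sum_(j < n) k j *: X`_j) = 0 by rewrite kX linear0.
rewrite linear_sum (bigD1 i)//= big1 => [|j ji]; rewrite XE linearZ /=.
  rewrite addr0 (joint_eigenvector_delta_pow _ wx) gi scale1r => /eqP.
  by rewrite scaler_eq0 (negbTE (rep_delta_pow_neq0 rho1 _ w0)) orbF => /eqP.
rewrite (joint_eigenvector_delta_pow _ wx) gs ?scale0r ?scaler0//.
by apply/mapP; exists (j : nat) => //; rewrite mem_filter mem_iota ltn_ord ji.
Qed.

End VectRep.

End JointEigenvectors.

(** * Irreducibility and universal property of the periodic representations *)

Section PeriodicRepresentations.
Variables (R : realType) (S : dynSystem).
Local Notation A := (ell1 R S).
Local Notation delta_pow := (delta_pow R S).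
Implicit Types (a b : A) (g : S -> R[i]).

Section OnePoint.
Variables (x : S) (l : circle R).
Local Notation p := (period x).
Implicit Types (i j : 'I_p) (v w : 'rV[R[i]]_p).

Lemma pi_mx_monom g (gc : continuous (g : S -> R[i]^o)) m j i :
  pi_mx x l (monom gc m) j i = pi_weight l (j%:Z + m) i * g (iterZ i x).
Proof.
rewrite mxE (@csum1 _ _ _ m) /= ?eqxx//.
by move=> n /negbTE ->; rewrite mulr0.
Qed.

Lemma pi_rep_delta_row a j : pi_rep x l a 'e_j = row j (pi_mx x l a).
Proof. by rewrite /= /pi_op -rowE. Qed.

Lemma pi_weight_small i j : pi_weight l i j = (i == j)%:R.
Proof.
rewrite /pi_weight modz_small ?divz_small ?ltz_nat ?ltn_ord// eqz_nat.
by rewrite -[_ == _ :> nat]/(i == j); case: (i == j).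
Qed.

(** No power of [l] appears, even for [j < i], since the index [i + (j - i)] stays between 0 and
    [p - 1]. *)
Lemma pi_rep_delta_pow i j : pi_rep x l (delta_pow (j%:Z - i%:Z)) 'e_i = 'e_j.
Proof.
rewrite pi_rep_delta_row; apply/rowP => k.
rewrite mxE pi_mx_monom mulr1 addrC subrK pi_weight_small.
by rewrite mxE eqxx eq_sym.
Qed.

(** This is how [l] is read off from the representation. *)
Lemma pi_rep_delta_pow_period v : pi_rep x l (delta_pow p) v = val l *: v.
Proof.
rewrite /= /pi_op -mul_mx_scalar; congr (_ *m _); apply/matrixP => j i.
rewrite pi_mx_monom mulr1 mxE -[p%:Z]mul1r addrC pi_weightMD expr1z.
by rewrite pi_weight_small mulr_natr.
Qed.

Lemma pi_rep_joint i : joint_eigenvector (pi_rep x l) (iterZ i x) 'e_i.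
Proof. by move=> g gc; exact: pi_rep_fun. Qed.

(** An explicit finite lift of [v] to the algebra, which makes ['e_i0] cyclic. *)
Lemma pi_rep_sum_delta_pow (i0 : 'I_p) v : i0 = 0%N :> nat ->
  pi_rep x l (\sum_j v 0 j *: delta_pow j) 'e_i0 = v.
Proof.
move=> i00; rewrite rep_sum [RHS]row_sum_delta; apply: eq_bigr => j _.
by rewrite repZ -(pi_rep_delta_pow i0 j) i00 subr0.
Qed.

(** A function isolating one point of the orbit projects a vector with nonzero coordinate there to a
    multiple of a basis vector; powers of delta then reach the others. *)
Lemma pi_rep_irreducible : Per S x -> alg_irreducible (pi_rep x l).
Proof.
move=> px; have [p0 _] := iterZ_period px; pose i0 := Ordinal p0.
have e0 : 'e_i0 != 0 :> 'rV[R[i]]_p.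
  apply/eqP => /rowP /(_ i0); rewrite !mxE !eqxx => /eqP.
  by rewrite oner_eq0.
split; first by exists 1, 'e_i0; rewrite pi_rep1.
move=> U [[U0 Ul] Ua].
have [Uz|[u [uU [i ui]]]] : (forall u, u \in U -> u = 0) \/
    exists u, u \in U /\ exists i, u 0 i != 0.
- apply: contrapT => /not_orP[/existsNP[u /not_implyP[uU u0]] nU].
  apply: nU; exists u; split=> //; apply: contrapT => /forallNP nu.
  by apply: u0; apply/rowP => i; rewrite mxE; apply/eqP/negPn/negP/nu.
- left => u; rewrite inE; apply/idP/eqP => [/Uz//|->//].
right => v; rewrite inE.
have [g [gc gi gs]] : exists g, [/\ continuous (g : S -> R[i]^o),
    g (iterZ i x) = 1 & {in [seq iterZ (j : nat) x | j <- enum 'I_p & j != i],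
      forall y, g y = 0}].
  apply: separating_function; apply/negP => /mapP[j].
  by rewrite mem_filter => /andP[ji _] /iterZ_ord_inj ij; rewrite ij eqxx in ji.
have ei : 'e_i \in U.
  have gu : pi_rep x l (monom gc 0) u = u 0 i *: 'e_i.
    have := fun j => pi_rep_joint j gc; move: (pi_rep x l) => rho gj.
    rewrite [in LHS](row_sum_delta u) rep_sumr (bigD1 i)//= big1 => [|j ji].
      by rewrite addr0 repZr gj gi scale1r.
    rewrite repZr gj gs ?scale0r ?scaler0//.
    by apply/mapP; exists j => //; rewrite mem_filter ji mem_enum.
  have := Ul (u 0 i)^-1 _ _ (Ua (monom gc 0) _ uU) U0.
  by rewrite gu addr0 scalerA mulVf// scale1r.
have ek k : 'e_k \in U by rewrite -(pi_rep_delta_pow i); exact: Ua.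
rewrite (row_sum_delta v); apply: (big_rec (fun s => s \in U)) => [//|j w _ wU].
exact: Ul.
Qed.

Section Universal.
Variables (E : lmodType R[i]) (rho : representation A E) (w : E).
Hypotheses (px : Per S x) (irr : alg_irreducible rho) (w0 : w != 0).
Hypotheses (wx : joint_eigenvector rho x w) (wl : rho (delta_pow p) w = val l *: w).

Let rho1 := irreducible_unital irr.

(** The intertwiner forced by [e_0 |-> w], as [e_j] is the image of [e_0] under [delta_pow j]. *)
Definition orbit_sum v : E := \sum_j v 0 j *: rho (delta_pow j) w.

Lemma orbit_sum_linear : linear orbit_sum.
Proof.
move=> c u v; rewrite /orbit_sum scaler_sumr -big_split /=.
by apply: eq_bigr => j _; rewrite !mxE scalerDl scalerA.
Qed.

HB.instance Definition _ :=
  GRing.isLinear.Build R[i] 'rV[R[i]]_p E *:%R orbit_sum orbit_sum_linear.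

Lemma orbit_sum_rep v : orbit_sum v = rho (\sum_j v 0 j *: delta_pow j) w.
Proof. by rewrite rep_sum; apply: eq_bigr => j _; rewrite repZ. Qed.

(** As [delta_pow p] multiplies [w] by [l], only the remainder of [m] matters, up to a power of
    [l]. *)
Lemma rep_delta_pow_mod m : exists2 i : 'I_p, (m %% p)%Z = i%:Z &
  rho (delta_pow m) w = (val l ^ (m %/ p)%Z) *: rho (delta_pow i) w.
Proof.
have [p0 _] := iterZ_period px; have pn0 : p%:Z != 0 by rewrite -lt0n.
have rp k : rho (delta_pow (p%:Z * k%:Z)) w = val l ^+ k *: w by exact: rep_delta_powX.
have rpz q : rho (delta_pow (q * p%:Z)) w = val l ^ q *: w.
  case: q => k; first by rewrite mulrC rp.
  (* A negative quotient reduces to the positive case after multiplication by [val l ^+ k.+1]. *)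
  have lk : val l ^+ k.+1 != 0 by rewrite expf_neq0// circle_neq0.
  apply: (scalerI lk); rewrite NegzE -exprnN scalerA divff// scale1r.
  rewrite -repZr -rp -repM -delta_powD [p%:Z * _]mulrC -mulrDl addNr mul0r.
  by rewrite delta_pow0 rho1.
have r0 : (0 <= m %% p)%Z by rewrite modz_ge0.
have rl : (m %% p < p)%Z by rewrite ltz_pmod.
have [i mi] : exists i : 'I_p, (m %% p)%Z = i%:Z.
  by case: (_ %% _)%Z r0 rl => // r _ rl; exists (Ordinal (rl : (r < p)%N)).
exists i => //.
by rewrite {1}(divz_eq m p) mi addrC delta_powD repM rpz repZr.
Qed.

(** In [pi_rep x l], the only coordinate of the image of ['e_i0] that can be nonzero is at [m]
    modulo the period. *)
Lemma orbit_sum_monom (i0 : 'I_p) g (gc : continuous (g : S -> R[i]^o)) m :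
  i0 = 0%N :> nat ->
  orbit_sum (pi_rep x l (monom gc m) 'e_i0) = rho (monom gc m) w.
Proof.
move=> i00; rewrite (rep_monom _ _ wx) pi_rep_delta_row.
have [i mi ->] := rep_delta_pow_mod m.
rewrite /orbit_sum (bigD1 i)//= big1 ?addr0.
  rewrite mxE pi_mx_monom i00 add0r /pi_weight mi eqxx scalerA mulrC.
  by rewrite (iterZ_weight (m := m) (i := i)) ?mi.
move=> j ji; rewrite mxE pi_mx_monom i00 add0r /pi_weight mi.
by rewrite eqz_nat eq_sym -[_ == _ :> nat]/(j == i) (negbTE ji) mul0r scale0r.
Qed.

Lemma pi_rep_coord_le a e j i : ell1_le a e ->
  normc (pi_rep x l a 'e_j 0 i) <= 2 * e.
Proof.
move=> [M [Ms aM] Me]; rewrite pi_rep_delta_row !mxE.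
apply: le_trans (normc_csum_le (pi_summable l a j%:Z i)) _.
rewrite mulr_natl lerMn2r/=; apply: le_trans Me.
apply: le_psum => // n /=; rewrite normc_ge0 normcM -[M n]mul1r.
by rewrite ler_pM ?normc_ge0// pi_weight_norm.
Qed.

(** Without continuity of [rho], the monomial case does not pass to the limit. Irreducibility
    instead turns a failure at [a] into a contradiction with [rep_contraction]. *)
Lemma orbit_sum_pi_rep (i0 : 'I_p) a : i0 = 0%N :> nat ->
  orbit_sum (pi_rep x l a 'e_i0) = rho a w.
Proof.
move=> i00; apply/eqP; rewrite eq_sym -subr_eq0; apply/negPn/negP.
(* [N b] is a combination of finitely many powers of delta acting on [e_0] as [b] does, so that
   [a - N a] kills [e_0]. *)
pose N b := \sum_j (pi_rep x l b 'e_i0) 0 j *: delta_pow j.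
have piN b : pi_rep x l (N b) 'e_i0 = pi_rep x l b 'e_i0 by exact: pi_rep_sum_delta_pow.
have oN b : orbit_sum (pi_rep x l b 'e_i0) = rho (N b) w by exact: orbit_sum_rep.
rewrite oN -repB => aw0.
have [b bw] := irreducible_cyclic irr aw0 w.
pose c := b * (a - N a).
have cw : rho c w = w by rewrite repM.
have pic : pi_rep x l c 'e_i0 = 0 by rewrite repM repB piN subrr linear0.
(* [t - N t] will have norm at most [e + p * (2 * e)], by [pi_rep_coord_le]; this is 1/4 for the
   present [e]. *)
pose e : R := (4 * (1 + p%:R * 2))^-1.
have e0 : 0 < e by rewrite invr_gt0 mulr_gt0// ltr_wpDr// mulr_ge0.
have [s [t [ct te]]] := ell1_approx c e0.
set f : A := \sum_(k <- s) _ in ct.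
have fw : rho f w = orbit_sum (pi_rep x l f 'e_i0).
  rewrite /f !rep_sum linear_sum; apply: eq_bigr => k _.
  exact: esym (orbit_sum_monom _ _ i00).
(* Since [c = f + t] kills [e_0], [rho f w = orbit_sum (f e_0) = - orbit_sum (t e_0) = - rho (N t)
   w]. *)
have tw : rho (t - N t) w = w.
  rewrite repB -oN -[RHS]cw ct repD fw [RHS]addrC; congr (_ + _).
  rewrite -linearN; congr orbit_sum; apply/eqP.
  by rewrite eq_sym -subr_eq0 opprK -repD -ct pic.
move/eqP: w0; apply; apply: (rep_contraction rho1 _ tw).
have -> : 4^-1 = e + p%:R * (2 * e) :> R.
  rewrite /e; field.
  by rewrite gt_eqF// ltr_wpDr// mulr_ge0.
apply: ell1_leD => //.
rewrite /N -sumrN; apply: ell1_le_sum => j; rewrite -scaleNr.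
apply: ell1_le_weaken (ell1_le_delta_pow _ _ _); rewrite normcN.
exact: pi_rep_coord_le.
Qed.

(** As [e_0] is cyclic, the intertwining relation at [e_0] extends to every vector, and Schur's
    lemma applies. *)
Lemma pi_rep_equivalent : alg_equivalent (pi_rep x l) rho.
Proof.
have [p0 _] := iterZ_period px; pose i0 := Ordinal p0.
have oM a v : orbit_sum (pi_rep x l a v) = rho a (orbit_sum v).
  pose b := \sum_j v 0 j *: delta_pow j.
  have <- : pi_rep x l b 'e_i0 = v by exact: pi_rep_sum_delta_pow.
  rewrite -repM.
  by rewrite !(orbit_sum_pi_rep _ (erefl : i0 = 0%N :> nat)) repM.
exists orbit_sum; split=> //.
apply: (intertwiner_bijective (pi_rep_irreducible px) irr oM (v := 'e_i0)).
rewrite [X in X != 0](_ : _ = w)//.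
by rewrite -[RHS]rho1 -(@orbit_sum_pi_rep i0)// pi_rep1.
Qed.

End Universal.

End OnePoint.

End PeriodicRepresentations.

(** * Classification up to equivalence *)

Section Classification.
Variables (R : realType) (S : dynSystem).
Local Notation A := (ell1 R S).
Local Notation delta_pow := (delta_pow R S).

(** Inside [pi_rep x l], the vector ['e_i] has the character of [iterZ i x] and the eigenvalue [l]
    for [delta_pow p], so the universal property applies with [w = 'e_i]. *)
Lemma pi_rep_orbit (x y : S) (l : circle R) : Per S x -> orbitZ x y ->
  alg_equivalent (pi_rep y l) (pi_rep x l).
Proof.
move=> px [n _ <-]; have [p0 _] := iterZ_period px.
have [i ni] : exists i : 'I_(period x), (n %% period x)%Z == i%:Z.
  have r0 : (0 <= n %% period x)%Z by rewrite modz_ge0// -lt0n.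
  have rl : (n %% period x < period x)%Z by rewrite ltz_pmod.
  by case: (_ %% _)%Z r0 rl => // r _ rl; exists (Ordinal (rl : (r < period x)%N)).
rewrite -(iterZ_weight ni).
apply: (@pi_rep_equivalent _ _ _ _ _ _ 'e_i).
- by rewrite -[Per S _]/(finite_set (orbitZ _)) orbitZ_iterZ.
- exact: pi_rep_irreducible.
- by apply/eqP => /rowP /(_ i); rewrite !mxE !eqxx => /eqP; rewrite oner_eq0.
- exact: pi_rep_joint.
- by rewrite /period orbitZ_iterZ -/(period x) pi_rep_delta_pow_period.
Qed.

(** The image of ['e_i0] keeps its character [x] and its eigenvalue [l]; in [pi_rep y m] the
    characters are points of the orbit of [y] and the eigenvalue is [m]. *)
Lemma pi_rep_inj (x y : S) (l m : circle R) : Per S x -> Per S y ->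
  alg_equivalent (pi_rep x l) (pi_rep y m) -> orbitZ x = orbitZ y /\ l = m.
Proof.
move=> px py [f [[g fK _] fM]].
have [p0 _] := iterZ_period px; pose i0 := Ordinal p0.
have e0 : 'e_i0 != 0 :> 'rV[R[i]]_(period x).
  by apply/eqP => /rowP /(_ i0); rewrite !mxE !eqxx => /eqP; rewrite oner_eq0.
pose u : 'rV_(period y) := f 'e_i0.
have u0 : u != 0.
  by apply: contra e0 => /eqP ue; apply/eqP/(can_inj fK); rewrite linear0.
have [j uj] : exists j, u 0 j != 0.
  apply: contrapT => /forallNP nu; move/eqP: u0; apply; apply/rowP => j.
  by rewrite mxE; apply/eqP/negPn/negP/nu.
have ju : iterZ j y = x.
  apply: contrapT => nyx.
  have [h [hc hx hy]] : exists h : S -> R[i], [/\ continuous (h : S -> R[i]^o),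
      h x = 1 & {in [:: iterZ j y], forall z, h z = 0}].
    by apply: separating_function; rewrite inE; apply/eqP => /esym.
  (* The function fixes [u] as [h x = 1], yet annihilates coordinate [j], where it takes the value
     0. *)
  have hu : pi_rep y m (monom hc 0) u = u.
    by rewrite -fM (pi_rep_joint l i0) hx scale1r.
  have := congr1 (fun v : 'rV_(period y) => v 0 j) hu => /=.
  rewrite /pi_op mxE (bigD1 j)//= big1 => [|k kj].
    rewrite pi_mx_monom hy ?inE// mulr0 mulr0 addr0 => /esym/eqP.
    by rewrite (negbTE uj).
  by rewrite pi_mx_monom addr0 pi_weight_small (negbTE kj) mul0r mulr0.
have oxy : orbitZ x = orbitZ y by rewrite -ju orbitZ_iterZ.
split=> //; apply/val_inj/eqP; rewrite -subr_eq0.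
have pxy : period x = period y by rewrite /period oxy.
have : (val l - val m) *: u = 0.
  have lu : pi_rep y m (delta_pow (period x)) u = val l *: u.
    by rewrite -fM pi_rep_delta_pow_period linearZ.
  rewrite scalerBl -lu -(pi_rep_delta_pow_period m u) -repB.
  have -> : delta_pow (period x) = delta_pow (period y) by rewrite pxy.
  by rewrite subrr rep0.
by move/eqP; rewrite scaler_eq0 (negbTE u0) orbF.
Qed.

Lemma irreducible_classification (E : vectType R[i]) (rho : representation A E) :
  alg_irreducible rho ->
  exists x (l : circle R), Per S x /\ alg_equivalent (pi_rep x l) rho.
Proof.
move=> irr; have rho1 := irreducible_unital irr.
have [v v0] := irreducible_neq0 irr.
have predTm : GRing.submod_closed (predT : {pred E}) by split.
pose CX := {g : S -> R[i] | continuous (g : S -> R[i]^o)}.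
have comm (g h : CX) u : u \in predT ->
    rho (monom (svalP g) 0) (rho (monom (svalP h) 0) u) =
    rho (monom (svalP h) 0) (rho (monom (svalP g) 0) u).
  move=> _; rewrite -!repM !monom0M; congr (rho _ u).
  by apply: monom_ext => // y; rewrite mulrC.
have [v' _ [v'0 ev]] := @common_eigenvector_family _ E CX
  (fun g => rho (monom (svalP g) 0)) predT v predTm (fun _ _ _ => isT)
  comm isT v0.
have [x v'x] : exists x, joint_eigenvector rho x v'.
  apply: (joint_eigenvectorP rho1 v'0) => g gc; have [c gv] := ev (exist _ g gc).
  by exists c; rewrite -gv; congr (rho _ v'); exact: monom_ext.
have px := joint_eigenvector_Per rho1 v'0 v'x.
have [_ pxx] := iterZ_period px.
(* [delta_pow (period x)] preserves this space since [x] returns to itself, so it has an eigenvector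
   there with the same character. *)
pose P : {pred E} := fun u => `[< joint_eigenvector rho x u >].
have Pm : GRing.submod_closed P.
  split; first by apply/asboolP => g gc; rewrite linear0 scaler0.
  move=> c a b /asboolP ax /asboolP bx; apply/asboolP => g gc.
  by rewrite linearP /= ax bx scalerDr !scalerA mulrC.
have [|w wP [w0 /(_ tt)[c wc]]] := @common_eigenvector_family _ E unit
  (fun=> rho (delta_pow (period x))) P v' Pm _ (fun _ _ _ _ => erefl) (asboolT v'x) v'0.
  move=> _ u /asboolP ux; apply/asboolP; rewrite -[X in joint_eigenvector _ X _]pxx.
  exact: joint_eigenvector_delta_pow.
have c1 := delta_pow_eigenvalue rho1 w0 wc.
exists x, (exist _ c c1); split=> //.
by apply: (@pi_rep_equivalent R S x (exist _ c c1) E rho w) => //; exact/asboolP.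
Qed.

End Classification.

(** * Invariant inner products and selfadjoint kernels *)

Section StarRepresentations.
Variables (R : realType) (S : dynSystem).
Local Notation A := (ell1 R S).

Section Pullback.
Variables (E : vectType R[i]) (n : nat) (f : {linear E -> 'rV[R[i]]_n}).

(** Positive definite only for injective [f], which enters in [pi_equivalent_star]. *)
Definition pullback_form (u v : E) : R[i] := dotmx (f u) (f v).

Lemma pullback_form_bilinear : bilinear_for
  (GRing.Scale.Law.clone _ _ *%R _) (GRing.Scale.Law.clone _ _ (Num.conj \; *%R) _)
  pullback_form.
Proof.
split=> [v|u] c x y; rewrite /pullback_form linearP.
- exact: linearPl.
- exact: linearPr.
Qed.

HB.instance Definition _ := bilinear_isBilinear.Build R[i] E E R[i] _ _
  pullback_form pullback_form_bilinear.

Lemma pullback_form_hermitian : forall u v,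
  pullback_form u v = (-1) ^+ false * Num.conj (pullback_form v u).
Proof. move=> u v; exact: hermC. Qed.

HB.instance Definition _ := isHermitianSesquilinear.Build R[i] E false Num.conj
  pullback_form pullback_form_hermitian.

End Pullback.

Lemma pi_equivalent_star (E : vectType R[i]) (rho : representation A E) x
    (l : circle R) : alg_equivalent (pi_rep x l) rho ->
  exists form : {dot E for Num.conj}, star_representation form rho.
Proof.
move=> /alg_equivalent_sym[f [[g fK _] fM]].
have fpos u : u != 0 -> 0 < pullback_form f u u.
  move=> u0; apply: neq0_dnorm_gt0; apply: contra u0 => /eqP fu.
  by apply/eqP/(can_inj fK); rewrite linear0.
pose form : {dot E for Num.conj} := HB.pack (pullback_form f)
  (isDotProduct.Build R[i] E (pullback_form f) fpos).
exists form => a u v.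
rewrite -[LHS]/(dotmx (f (rho a u)) (f v)) -[RHS]/(dotmx (f u) (f (rho (star a) v))).
by rewrite !fM pi_rep_star.
Qed.

Lemma starK : involutive (@star R S).
Proof.
move=> a; apply: ell1_eqP => n x.
by rewrite /= /star_fun /= /star_fun opprK iterZVK conjcK.
Qed.

(** If [a] acts as zero, then [<a^* v, a^* v> = <a a^* v, v> = 0]. *)
Lemma star_representation_ker (E : lmodType R[i]) (rho : representation A E)
    (form : {dot E for Num.conj}) :
  star_representation form rho -> selfadjoint (rep_ker rho).
Proof.
move=> st; have ks a : rep_ker rho a -> rep_ker rho (star a).
  move=> ka v; apply: contrapT => /eqP av.
  have := neq0_dnorm_gt0 (s := form) _ av.
  by rewrite -st ka linear0l ltxx.
apply/seteqP; split=> [_ [a /ks ka <-//]|a ka].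
by exists (star a); [exact: ks|exact: starK].
Qed.

End StarRepresentations.

Theorem theorem3p5 (R : realType) (S : dynSystem) :
  [/\ (exists rho : fdrep (ell1 R S), alg_irreducible rho) <->
        Per S !=set0,
      Per S !=set0 ->
        (forall (x y : S) (l : circle R), Per S x -> orbitZ x y ->
           alg_class (pi_fdrep y l) = alg_class (pi_fdrep x l)) /\
        (exists Xi : set S -> circle R -> rep_class (ell1 R S),
          [/\ forall (o : set S) (l : circle R) (x : S),
                finite_orbits o -> o x -> Xi o l = alg_class (pi_fdrep x l),
              forall (o : set S) (l : circle R),
                finite_orbits o -> fd_irr_class (Xi o l),
              forall (o o' : set S) (l l' : circle R),
                finite_orbits o -> finite_orbits o' ->
                Xi o l = Xi o' l' -> o = o' /\ l = l' &
              forall c : rep_class (ell1 R S), fd_irr_class c ->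
                exists (o : set S) (l : circle R),
                  finite_orbits o /\ Xi o l = c]) &
      forall rho : fdrep (ell1 R S), alg_irreducible rho ->
        (exists form : {dot (fdspace rho) for Num.conj},
           star_representation form rho) /\
        selfadjoint (rep_ker rho)].
Proof.
have well (x y : S) (l : circle R) : Per S x -> orbitZ x y ->
    alg_class (pi_fdrep y l) = alg_class (pi_fdrep x l).
  by move=> px xy; apply/alg_classP; exact: pi_rep_orbit.
split.
- split=> [[rho irr]|[x px]].
    by have [x [_ [px _]]] := irreducible_classification irr; exists x.
  have l1 : `|1 : R[i]| == 1 by rewrite normr1.
  by exists (pi_fdrep x (exist _ 1 l1)); exact: pi_rep_irreducible.
- move=> [x0 _]; split=> //.
  (* [xget] chooses a point of [o]; the default [x0] matters only for an empty set, and orbits are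
     nonempty. *)
  pose Xi (o : set S) (l : circle R) := alg_class (pi_fdrep (xget x0 o) l).
  have XiE x l : Per S x -> Xi (orbitZ x) l = alg_class (pi_fdrep x l).
    move=> px; apply: well => //; apply: xgetPex.
    by exists x; exact: orbitZ_refl.
  exists Xi; split.
  + by move=> _ l y [x px <-] xy; rewrite XiE// (well _ _ _ px xy).
  + move=> _ l [x px <-]; rewrite XiE//.
    by exists (pi_fdrep x l) => //; exact: pi_rep_irreducible.
  + move=> _ _ l l' [x px <-] [y py <-]; rewrite !XiE// => /alg_classP.
    exact: pi_rep_inj.
  + move=> _ [rho irr ->].
    have [x [l [px e]]] := irreducible_classification irr.
    exists (orbitZ x), l; split; first by exists x.
    by rewrite XiE//; apply/alg_classP.
- move=> rho irr; have [x [l [_ e]]] := irreducible_classification irr.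
  have [form st] := pi_equivalent_star e.
  by split; [exists form|exact: star_representation_ker st].
Qed.
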